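(* Let $X$ be a complete median space of finite rank and let $\Gamma$ be a group with an action $\Gamma\curvearrowright X$ by isometries. Suppose that $\Gamma$ has no nonabelian free subgroups. \begin{itemize} \item If the action is free, then $\Gamma$ is virtually finite-by-abelian. If moreover $X$ is connected or $\Gamma$ is finitely generated, then $\Gamma$ is virtually abelian. \item If the action is metrically proper, then $\Gamma$ is virtually (locally finite)-by-abelian. \item If all point stabilisers $\Gamma_x$, $x\in X$, are amenable, then $\Gamma$ is amenable. \end{itemize}
   Context: A median space is a metric space $(X,d)$ such that for all $x,y,z\in X$ the set $I(x,y)\cap I(y,z)\cap I(z,x)$ consists of exactly one point, where $I(x,y)=\{z\in X: d(x,z)+d(z,y)=d(x,y)\}$. A subset $C\subseteq X$ is convex if $I(x,y)\subseteq C$ for all $x,y\in C$. A halfspace is a nonempty proper convex subset $\mathfrak h\subseteq X$ whose complement $\mathfrak h^*=X\setminus\mathfrak h$ is convex. Two halfspaces $\mathfrak h,\mathfrak k$ are transverse if $\mathfrak h\cap\mathfrak k$, $\mathfrak h\cap\mathfrak k^*$, $\mathfrak h^*\cap\mathfrak k$, $\mathfrak h^*\cap\mathfrak k^*$ are all nonempty. The rank of $X$ is the maximal cardinality of a set of pairwise transverse halfspaces. The action is metrically proper if for every $x\in X$ and $R>0$ only finitely many $g\in\Gamma$ satisfy $d(x,gx)\le R$. ''Virtually $P$-by-abelian'' means that $\Gamma$ has a finite-index subgroup $\Gamma_0$ with a normal subgroup $N$ having property $P$ and $\Gamma_0/N$ abelian. Groups are regarded as discrete groups. *)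

(* Defs.v *)
From Stdlib Require Import Reals List Lia.
Open Scope R_scope.

Record Group := {
  carrier :> Type;
  gmul : carrier -> carrier -> carrier;
  ginv : carrier -> carrier;
  gone : carrier;
  gmul_assoc : forall a b c, gmul a (gmul b c) = gmul (gmul a b) c;
  gmul_1l : forall a, gmul gone a = a;
  gmul_Vl : forall a, gmul (ginv a) a = gone
}.
Arguments gmul {_} _ _.
Arguments ginv {_} _.
Arguments gone {_}.

Section GroupDefs.
Variable G : Group.

Definition finite_set {T : Type} (P : T -> Prop) : Prop :=
  exists l : list T, forall x, P x -> In x l.

Definition subgroup (H : G -> Prop) : Prop :=
  H gone /\ (forall a b, H a -> H b -> H (gmul a b)) /\ (forall a, H a -> H (ginv a)).

Definition finite_index (H0 : G -> Prop) : Prop :=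
  subgroup H0 /\
  exists l : list G, forall g : G, exists h, In h l /\ H0 (gmul (ginv h) g).

Definition normal_in (N H0 : G -> Prop) : Prop :=
  subgroup N /\ (forall x, N x -> H0 x) /\
  (forall g x, H0 g -> N x -> N (gmul (gmul (ginv g) x) g)).

Definition abelian_quotient (H0 N : G -> Prop) : Prop :=
  forall a b, H0 a -> H0 b -> N (gmul (gmul (ginv a) (ginv b)) (gmul a b)).

Definition abelian_sub (H : G -> Prop) : Prop :=
  forall a b, H a -> H b -> gmul a b = gmul b a.

Definition generated (l : list G) (x : G) : Prop :=
  forall K, subgroup K -> (forall y, In y l -> K y) -> K x.

Definition finitely_generated : Prop :=
  exists l : list G, forall g, generated l g.

Definition finite_sub (N : G -> Prop) : Prop := finite_set N.

Definition locally_finite_sub (N : G -> Prop) : Prop :=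
  forall l : list G, (forall y, In y l -> N y) -> finite_set (generated l).

Definition virtually_by_abelian (P : (G -> Prop) -> Prop) : Prop :=
  exists H0 N : G -> Prop,
    finite_index H0 /\ normal_in N H0 /\ P N /\ abelian_quotient H0 N.

Definition virtually_abelian : Prop :=
  exists H0 : G -> Prop, finite_index H0 /\ abelian_sub H0.

Definition letter_eval (a b : G) (c : bool * bool) : G :=
  let g := if fst c then a else b in if snd c then ginv g else g.

Fixpoint word_eval (a b : G) (w : list (bool * bool)) : G :=
  match w with
  | nil => gone
  | c :: w' => gmul (letter_eval a b c) (word_eval a b w')
  end.

Fixpoint reduced (w : list (bool * bool)) : Prop :=
  match w with
  | c1 :: ((c2 :: _) as w') =>
      ~ (fst c1 = fst c2 /\ snd c1 = negb (snd c2)) /\ reduced w'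
  | _ => True
  end.

(* G contains a nonabelian free subgroup iff it contains a free subgroup of
   rank 2, i.e. two elements a, b on which no nontrivial reduced word vanishes *)
Definition has_nonabelian_free_subgroup : Prop :=
  exists a b : G, forall w, w <> nil -> reduced w -> word_eval a b w <> gone.

Definition amenable_sub (H : G -> Prop) : Prop :=
  exists m : (G -> Prop) -> R,
    (forall A, (forall x, A x -> H x) -> 0 <= m A) /\
    m H = 1 /\
    (forall A B, (forall x, A x -> H x) -> (forall x, B x -> H x) ->
       (forall x, A x -> B x -> False) ->
       m (fun x => A x \/ B x) = m A + m B) /\
    (forall g A, H g -> (forall x, A x -> H x) ->
       m (fun x => A (gmul (ginv g) x)) = m A).

Definition amenable : Prop := amenable_sub (fun _ => True).

End GroupDefs.

Section MetricDefs.
Variable X : Type.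
Variable d : X -> X -> R.

Definition is_metric : Prop :=
  (forall x y, 0 <= d x y) /\ (forall x y, d x y = 0 <-> x = y) /\
  (forall x y, d x y = d y x) /\ (forall x y z, d x z <= d x y + d y z).

Definition interval (x y z : X) : Prop := d x z + d z y = d x y.

Definition median_space : Prop :=
  is_metric /\
  forall x y z, exists! m, interval x y m /\ interval y z m /\ interval z x m.

Definition cauchy (u : nat -> X) : Prop :=
  forall eps, 0 < eps -> exists N, forall p q, (N <= p)%nat -> (N <= q)%nat -> d (u p) (u q) < eps.

Definition converges (u : nat -> X) (l : X) : Prop :=
  forall eps, 0 < eps -> exists N, forall n, (N <= n)%nat -> d (u n) l < eps.

Definition complete : Prop := forall u, cauchy u -> exists l, converges u l.

Definition open_set (U : X -> Prop) : Prop :=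
  forall x, U x -> exists eps, 0 < eps /\ forall y, d x y < eps -> U y.

Definition connected_space : Prop :=
  ~ exists U V : X -> Prop, open_set U /\ open_set V /\
      (exists x, U x) /\ (exists x, V x) /\
      (forall x, U x \/ V x) /\ (forall x, U x -> V x -> False).

Definition convex (C : X -> Prop) : Prop :=
  forall x y z, C x -> C y -> interval x y z -> C z.

Definition halfspace (h : X -> Prop) : Prop :=
  (exists x, h x) /\ (exists x, ~ h x) /\ convex h /\ convex (fun x => ~ h x).

Definition transverse (h k : X -> Prop) : Prop :=
  (exists x, h x /\ k x) /\ (exists x, h x /\ ~ k x) /\
  (exists x, ~ h x /\ k x) /\ (exists x, ~ h x /\ ~ k x).

(* finite rank: cardinalities of families of pairwise transverse
   halfspaces are bounded (pairwise transverse halfspaces are distinct) *)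
Definition finite_rank : Prop :=
  exists n : nat, forall l : list (X -> Prop),
    (forall h, In h l -> halfspace h) ->
    (forall i j, (i < j < length l)%nat ->
       transverse (nth i l (fun _ => False)) (nth j l (fun _ => False))) ->
    (length l <= n)%nat.

End MetricDefs.

Definition isometric_action (G : Group) (X : Type) (d : X -> X -> R)
  (act : G -> X -> X) : Prop :=
  (forall x, act gone x = x) /\
  (forall g h x, act (gmul g h) x = act g (act h x)) /\
  (forall g x y, d (act g x) (act g y) = d x y).

Definition free_action (G : Group) (X : Type) (act : G -> X -> X) : Prop :=
  forall g x, act g x = x -> g = gone.

Definition metrically_proper (G : Group) (X : Type) (d : X -> X -> R)
  (act : G -> X -> X) : Prop :=
  forall x (r : R), finite_set (fun g : G => d x (act g x) <= r).

Definition stabiliser (G : Group) (X : Type) (act : G -> X -> X) (x : X) : G -> Prop :=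
  fun g => act g x = x.

(* Main.v *)
(** Work with ultrafilters of halfspaces (points at infinity) instead of a measure on the set of
    halfspaces.  Take a maximal [G]-invariant family [F] of pairwise intersecting halfspaces.  By
    maximality every halfspace that [F] does not decide can be flipped into its complement by an
    element of [G], so three pairwise disjoint undecided halfspaces would give a ping-pong pair.
    Without free subgroups the undecided halfspaces therefore fall into finitely many classes, each
    of which can be added to [F], and a finite-index subgroup fixes an ultrafilter [sigma].

    A halfspace of [sigma] that is mapped strictly inside itself has an "end" at infinity.  There
    are at most [r] ends, so a finite-index subgroup [H] fixes them all, and the Busemann cocycle
    of an end is a homomorphism [H -> R] that is nonzero on the elements skewering towards this
    end.  Hence no element of [[H, H]] skewers a halfspace of [sigma].  A finitely generated group
    that fixes [sigma] and skewers nothing has a fixed point: the meets, towards [sigma], of the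
    translates of a base point converge, for otherwise they cross an infinite thick chain of
    halfspaces, and pulling this chain back to the base point produces a skewering element or
    [r + 1] pairwise transverse halfspaces.

    So every finitely generated subgroup of [[H, H]] fixes a point.  It follows that [[H, H]] is
    trivial for free actions and locally finite for proper ones.  For amenable stabilisers,
    averaging Dirac masses over the abelian group [H / [H, H]] and passing to an ultralimit gives
    an invariant mean on [X], which is integrated against the means of the stabilisers. *)

Require Import Defs.
From Corelib Require Import ssreflect.
From Stdlib Require Import Reals List Lra Lia Arith Classical ClassicalEpsilon.
From mathcomp Require classical_sets filter.
From Stdlib Require Import FunctionalExtensionality PropExtensionality Permutation.

(** The obstacle is metric: halfspaces come from Zorn's lemma, need be neither open nor closed, and
    strictly nested ones may have touching boundaries, so inclusions alone control no distances.
    Finite rank restores this control through one principle: inside an interval, a join of many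
    points is already a join of at most [r] of them. Consequently the convex hull of a
    [rho]-neighbourhood stays within [r * rho], which gives separating halfspaces of prescribed
    thickness, and a chain with [r + 1] nonempty layers cannot collapse at a single point, so some
    power of a skewering element moves its halfspace by a definite distance. Distances to halfspaces
    then grow linearly under skewering, which makes the Busemann cocycle nonzero and ends
    distinguishable by depth. Fixed points are found for finitely generated subgroups only, because
    the descent takes the meet of finitely many translates at each step; this is why properness
    yields local finiteness of the kernel. *)

Lemma pred_ext {T : Type} (P Q : T -> Prop) : (forall x, P x <-> Q x) -> P = Q.
Proof. by move=> h; apply: functional_extensionality => x; apply/propositional_extensionality. Qed.

(** [Zorn_bigcup] also asks about the empty chain. Applying it to the sets whose union with [A]
    satisfies [P] settles that case by [P A], so [hP] only concerns nonempty chains. *)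
Lemma zorn_above {T : Type} (P : (T -> Prop) -> Prop) (A : T -> Prop) :
  P A ->
  (forall F : (T -> Prop) -> Prop, (exists S, F S) ->
     (forall S, F S -> P S) ->
     (forall S S', F S -> F S' -> (forall x, S x -> S' x) \/ (forall x, S' x -> S x)) ->
     P (fun x => exists2 S, F S & S x)) ->
  exists M, P M /\ (forall x, A x -> M x) /\
    forall M', P M' -> (forall x, M x -> M' x) -> forall x, M' x -> M x.
Proof.
move=> PA hP.
pose Q (S : T -> Prop) := P (fun x => A x \/ S x).
have [F hF htot|S [QS hmax]] := @classical_sets.Zorn_bigcup T Q.
  rewrite /Q; case: (classic (exists S, F S)) => [[S0 FS0]|hE]; last first.
    have -> // : (fun x => A x \/ classical_sets.bigcup F (fun S => S) x) = A.
    apply: pred_ext => x; split=> [[//|[S FS _]]|]; last by left.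
    by case: hE; exists S.
  pose F' (S' : T -> Prop) := exists2 S, F S & S' = (fun x => A x \/ S x).
  have -> : (fun x => A x \/ classical_sets.bigcup F (fun S => S) x) =
            (fun x => exists2 S', F' S' & S' x).
    apply: pred_ext => x; split.
      case=> [hA|[S FS hS]]; first by exists (fun x => A x \/ S0 x); [exists S0|left].
      by exists (fun x => A x \/ S x); [exists S|right].
    case=> S' [S FS ->] [hA|hS]; [by left|by right; exists S].
  apply: hP.
  - by exists (fun x => A x \/ S0 x), S0.
  - by move=> S' [S FS ->]; apply: hF.
  - move=> S1' S2' [S1 F1 ->] [S2 F2 ->].
    by case: (htot S1 S2 F1 F2) => h; [left|right] => x [hA|hS];
      [left|right; apply: h|left|right; apply: h].
exists (fun x => A x \/ S x); split=> //; split; first by left.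
move=> M' PM' sub x hM'.
apply: NNPP => hx; apply: (hmax M').
  split; first by move=> y Sy; apply: sub; right.
  by move=> h; apply: hx; right; apply: h.
rewrite /Q; have -> // : (fun x => A x \/ M' x) = M'.
by apply: pred_ext => y; split=> [[hA|//]|]; [apply: sub; left|right].
Qed.

Lemma infimum (P : R -> Prop) : (exists t, P t) -> (forall t, P t -> 0 <= t) ->
  exists m, (forall t, P t -> m <= t) /\ forall e, 0 < e -> exists t, P t /\ t < m + e.
Proof.
move=> [t0 Pt0] hP.
have [||m [ub lub]] := completeness (fun t => P (- t)).
- by exists 0 => t /hP; lra.
- by exists (- t0); rewrite Ropp_involutive.
exists (- m); split=> [t Pt|e he].
  by have := ub (- t); rewrite Ropp_involutive => /(_ Pt); lra.
apply: NNPP => hn; suff : m <= m - e by lra.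
apply: lub => t Pt; apply: Rnot_lt_le => hlt; apply: hn.
by exists (- t); split=> //; lra.
Qed.

Notation "a ** b" := (gmul a b) (at level 40, left associativity).

(** * Elementary group theory *)

Section GroupTheory.
Variable G : Group.
Implicit Types a b c : G.

Lemma gmulA a b c : a ** (b ** c) = a ** b ** c.
Proof. exact: gmul_assoc. Qed.

Lemma gmul1 a : gone ** a = a.
Proof. exact: gmul_1l. Qed.

Lemma gmulV a : ginv a ** a = gone.
Proof. exact: gmul_Vl. Qed.

Lemma gVmul a : a ** ginv a = gone.
Proof.
rewrite -(gmul1 (a ** ginv a)) -{1}(gmulV (ginv a)) gmulA -(gmulA (ginv (ginv a))) gmulV.
by rewrite -gmulA gmul1 gmulV.
Qed.

Lemma gmul1r a : a ** gone = a.
Proof. by rewrite -(gmulV a) gmulA gVmul gmul1. Qed.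

Lemma gmulK a b : a ** b ** ginv b = a.
Proof. by rewrite -gmulA gVmul gmul1r. Qed.

Lemma gmulVK a b : a ** ginv b ** b = a.
Proof. by rewrite -gmulA gmulV gmul1r. Qed.

Lemma ginv_eq a b : a ** b = gone -> ginv a = b.
Proof. by move=> h; rewrite -(gmul1r (ginv a)) -h gmulA gmulV gmul1. Qed.

Lemma ginvK a : ginv (ginv a) = a.
Proof. exact/ginv_eq/gmulV. Qed.

Lemma ginvM a b : ginv (a ** b) = ginv b ** ginv a.
Proof. by apply: ginv_eq; rewrite gmulA gmulK gVmul. Qed.

Lemma ginv1 : ginv (gone : G) = gone.
Proof. exact/ginv_eq/gmul1. Qed.

Lemma ginv_mulK a b : ginv a ** (a ** b) = b.
Proof. by rewrite gmulA gmulV gmul1. Qed.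

Lemma gmul_ginvK a b : a ** (ginv a ** b) = b.
Proof. by rewrite gmulA gVmul gmul1. Qed.

Fixpoint gpow a (n : nat) : G := if n is S m then a ** gpow a m else gone.

Lemma gpowD a m n : gpow a (m + n) = gpow a m ** gpow a n.
Proof. by elim: m => [|m IH] /=; rewrite ?gmul1 // IH gmulA. Qed.

Lemma gpowS_r a n : gpow a (S n) = gpow a n ** a.
Proof. by rewrite -Nat.add_1_r gpowD /= gmul1r. Qed.

Lemma gpow_sub (H : G -> Prop) a n : subgroup G H -> H a -> H (gpow a n).
Proof. by move=> [h1 [h2 _]] ha; elim: n => [//|n IH] /=; apply: h2. Qed.

End GroupTheory.

Arguments gpow {G} a n.

(** * Finite selections and infinite subsequences *)

Lemma ForallOrdPairs_nth {T : Type} (R : T -> T -> Prop) l x0 i j :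
  ForallOrdPairs R l -> (i < j < length l)%nat -> R (nth i l x0) (nth j l x0).
Proof.
move=> h; elim: h i j => {l} [|a l ha _ IH] [|i] [|j] /= hij; try lia.
  by move/Forall_forall: ha; apply; apply: nth_In; lia.
by apply: IH; lia.
Qed.

Lemma maximal_unrelated {T : Type} (P : T -> Prop) (R : T -> T -> Prop) n :
  (forall l, (forall x, In x l -> P x) -> ForallOrdPairs (fun a b => ~ R a b) l ->
    (length l <= n)%nat) ->
  exists l, (forall x, In x l -> P x) /\ ForallOrdPairs (fun a b => ~ R a b) l /\
    forall x, P x -> exists2 y, In y l & R x y.
Proof.
move=> hn.
have key m : forall l, (forall x, In x l -> P x) -> ForallOrdPairs (fun a b => ~ R a b) l ->
    (n <= length l + m)%nat ->
    exists l, (forall x, In x l -> P x) /\ ForallOrdPairs (fun a b => ~ R a b) l /\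
      forall x, P x -> exists2 y, In y l & R x y.
  elim: m => [|m IH] l hl hR hlen.
    exists l; split=> //; split=> // x Px; apply: NNPP => hx.
    suff : (length (x :: l) <= n)%nat by rewrite /=; lia.
    apply: hn; first by move=> y [<-|/hl].
    by constructor=> //; apply/Forall_forall => y hy hxy; apply: hx; exists y.
  case: (classic (forall x, P x -> exists2 y, In y l & R x y)) => [h|]; first by exists l.
  move=> /not_all_ex_not [x hx]; have [Px nx] := imply_to_and _ _ hx.
  apply: (IH (x :: l)); last by rewrite /=; lia.
    by move=> y [<-|/hl].
  by constructor=> //; apply/Forall_forall => y hy hxy; apply: nx; exists y.
by apply: (key n nil); [|constructor|lia].
Qed.

Lemma list_minimal {T : Type} (le : T -> T -> Prop) (l : list T) :
  (forall a, le a a) -> (forall a b c, le a b -> le b c -> le a c) ->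
  (forall a b, le a b -> le b a -> a = b) -> l <> nil ->
  exists m, In m l /\ forall a, In a l -> le a m -> a = m.
Proof.
move=> refl trans anti; elim: l => [//|a [|b l] IH] _.
  by exists a; split; [left|move=> x [->|]].
have [//|m [hm hmin]] := IH; case: (classic (le a m)) => ham.
  exists a; split; [by left|move=> x [<- //|hx] hxa].
  have e : x = m by apply: hmin => //; apply: trans ham.
  by rewrite e; apply: anti => //; rewrite -e.
by exists m; split; [right|move=> x [<- //|]; apply: hmin].
Qed.

Lemma list_bound {T : Type} (Q : T -> R -> Prop) (l : list T) :
  (forall x b c, Q x b -> b <= c -> Q x c) -> (forall x, In x l -> exists b, Q x b) ->
  exists b, forall x, In x l -> Q x b.
Proof.
move=> mono; elim: l => [|a l IH] h; first by exists 0.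
have [b hb] := IH (fun x hx => h x (or_intror hx)); have [c hc] := h a (or_introl eq_refl).
exists (Rmax b c) => x [<-|/hb hx]; first by apply: mono hc _; apply: Rmax_r.
by apply: mono hx _; apply: Rmax_l.
Qed.

Lemma dependent_choice {T : Type} (P : T -> Prop) (E : T -> T -> Prop) x0 :
  P x0 -> (forall x, P x -> exists y, P y /\ E x y) ->
  exists f : nat -> T, f 0%nat = x0 /\ forall n, P (f n) /\ E (f n) (f (S n)).
Proof.
move=> P0 step.
have step' (u : {x | P x}) : exists v : {x | P x}, E (proj1_sig u) (proj1_sig v).
  by case: u => x Px; have [y [Py hy]] := step x Px; exists (exist _ y Py).
pose nxt u := proj1_sig (constructive_indefinite_description _ (step' u)).
pose f := fix f n : {x | P x} := if n is S m then nxt (f m) else exist _ x0 P0.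
exists (fun n => proj1_sig (f n)); split=> // n; split; first exact: proj2_sig.
exact: (proj2_sig (constructive_indefinite_description _ (step' (f n)))).
Qed.

Definition increasing (phi : nat -> nat) : Prop := forall i, (phi i < phi (S i))%nat.

Lemma increasing_lt phi i j : increasing phi -> (i < j)%nat -> (phi i < phi j)%nat.
Proof. by move=> h; elim=> [|k _ IH] //; apply: Nat.lt_trans IH _. Qed.

Lemma increasing_comp phi psi : increasing phi -> increasing psi -> increasing (fun i => phi (psi i)).
Proof. by move=> h1 h2 i; apply: increasing_lt. Qed.

Lemma infinite_subsequence (Q : nat -> Prop) : (forall n, exists2 j, (n < j)%nat & Q j) ->
  exists phi, increasing phi /\ forall m, Q (phi m).
Proof.
move=> h; have [j0 _ Q0] := h 0%nat.
have [|phi [_ hphi]] := dependent_choice Q lt j0 Q0.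
  by move=> x _; have [y hxy Qy] := h x; exists y.
by exists phi; split=> m; case: (hphi m).
Qed.

(** If some [i] is unrelated to infinitely many later indices, pass to those: prepending [i]
    lengthens any unrelated family found there, so induction on [n] applies. Otherwise every index
    is related to all sufficiently late ones, and a fast enough sequence works. *)
Lemma ramsey n : forall E : nat -> nat -> Prop,
  (forall phi, increasing phi -> ~ forall i j, (i < j <= n)%nat -> ~ E (phi i) (phi j)) ->
  exists phi, increasing phi /\ forall i j, (i < j)%nat -> E (phi i) (phi j).
Proof.
elim: n => [|n IH] E hE.
  by case: (hE (fun i => i)) => [i|i j]; lia.
case: (classic (exists i, forall N, exists2 j, (N < j)%nat & (i < j)%nat /\ ~ E i j)) => [[i hi]|hfin].
  have [psi [hpsi hpsi']] := infinite_subsequence _ hi.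
  have [phi hphi hbad|phi [hphi hgood]] := IH (fun a b => E (psi a) (psi b)).
    apply: (hE (fun m => if m is S m' then psi (phi m') else i)).
      move=> [|m]; first by case: (hpsi' (phi 0%nat)).
      exact: (increasing_comp _ _ hpsi hphi).
    move=> [|a] [|b] hab; try lia; first by case: (hpsi' (phi b)).
    by apply: hbad; lia.
  by exists (fun m => psi (phi m)); split=> //; apply: increasing_comp.
have hN i : exists N, forall j, (N < j)%nat -> (i < j)%nat -> E i j.
  apply: NNPP => hn; apply: hfin; exists i => N; apply: NNPP => hn'; apply: hn; exists N => j h1 h2.
  by apply: NNPP => h3; apply: hn'; exists j.
have hB m : exists B, forall i j, (i <= m)%nat -> (B < j)%nat -> (i < j)%nat -> E i j.
  elim: m => [|m [B hB]].
    by have [N h] := hN 0%nat; exists N => i j hi; have -> : i = 0%nat by [lia]; apply: h.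
  have [N h] := hN (S m); exists (max N B) => i j hi hj hij.
  have [e|hlt] : i = S m \/ (i <= m)%nat by lia.
    by rewrite e; apply: h; lia.
  by apply: hB; lia.
have [|phi [_ hphi]] := dependent_choice (fun _ => True)
    (fun m m' => (m < m')%nat /\ forall i j, (i <= m)%nat -> (m' <= j)%nat -> E i j) 0%nat I.
  move=> m _; have [B h] := hB m; exists (S (max m B)); split=> //.
  by split=> [|i j hi hj]; [lia|apply: h; lia].
have hinc : increasing phi by move=> i; case: (hphi i) => _ [].
exists phi; split=> // i j; have [_ [_ h]] := hphi i => hij; apply: h => //.
have [->//|hlt] : j = S i \/ (S i < j)%nat by lia.
exact/Nat.lt_le_incl/increasing_lt.
Qed.

(** * Finite-index and commutator subgroups *)

Section FiniteIndex.
Variable G : Group.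

(** Orbit-stabiliser counting: multiply the coset representatives of [H0] by one representative for
    each value of [phi]. *)
Lemma finite_index_refine {T : Type} (H0 K : G -> Prop) (phi : G -> T) (l : list T) :
  finite_index G H0 -> subgroup G K -> (forall g, H0 g -> In (phi g) l) ->
  (forall a b, H0 a -> H0 b -> phi a = phi b -> K (ginv a ** b)) -> finite_index G K.
Proof.
move=> [hH0 [l0 hl0]] hK hphi hab; split=> //.
have hb t : exists b, forall g, H0 g -> phi g = t -> H0 b /\ phi b = t.
  case: (classic (exists2 g, H0 g & phi g = t)) => [[g h1 h2]|hn]; first by exists g.
  by exists gone => g h1 h2; case: hn; exists g.
pose b t := proj1_sig (constructive_indefinite_description _ (hb t)).
have hb' t : forall g, H0 g -> phi g = t -> H0 (b t) /\ phi (b t) = t.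
  exact: (proj2_sig (constructive_indefinite_description _ (hb t))).
exists (flat_map (fun a => map (fun t => a ** b t) l) l0) => g.
have [a [ha hga]] := hl0 g.
have [h1 h2] := hb' _ _ hga eq_refl.
exists (a ** b (phi (ginv a ** g))); split.
  apply/in_flat_map; exists a; split=> //.
  by apply/in_map_iff; exists (phi (ginv a ** g)); split=> //; apply: hphi.
by rewrite ginvM -gmulA; apply: hab.
Qed.

Lemma finite_index_stabiliser {T : Type} (op : G -> T -> T) (H0 : G -> Prop) (P : T -> Prop) :
  (forall t, op gone t = t) -> (forall a b t, op (a ** b) t = op a (op b t)) ->
  finite_index G H0 -> (forall g t, H0 g -> P t -> P (op g t)) -> finite_set P ->
  finite_index G (fun g => H0 g /\ forall t, P t -> op g t = t).
Proof.
move=> op1 opM hH0 hP [l hl].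
have opV g t : op g t = t -> op (ginv g) t = t.
  by move=> h; rewrite -{1}h -opM gmulV op1.
have [sH0 _] := hH0; have [s1 [sM sV]] := sH0.
have hsub (Q : T -> Prop) : subgroup G (fun g => H0 g /\ forall t, Q t -> op g t = t).
  split; first by split=> // t _; apply: op1.
  split=> [a b [Ha ha] [Hb hb]|a [Ha ha]].
    by split=> [|t Qt]; [apply: sM|rewrite opM hb // ha].
  by split=> [|t Qt]; [apply: sV|apply/opV/ha].
have key m : finite_index G (fun g => H0 g /\ forall t, (P t /\ In t m) -> op g t = t).
  elim: m => [|t m IH].
    apply: (finite_index_refine _ _ (fun _ => tt) (tt :: nil) hH0) => //; first by left.
    by move=> a b Ha Hb _; split=> [|t []//]; apply: sM => //; apply: sV.
  case: (classic (P t)) => Pt; last first.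
    apply: (finite_index_refine _ _ (fun _ => tt) (tt :: nil) IH) => //; first by left.
    move=> a b [Ha ha] [Hb hb] _; split; first by apply: sM => //; apply: sV.
    by move=> t' [Pt' [e|ht]]; [rewrite -e in Pt'|rewrite opM hb // opV // ha].
  apply: (finite_index_refine _ _ (fun g => op g t) l IH) => //.
    by move=> g [Hg _]; apply/hl/hP.
  move=> a b [Ha ha] [Hb hb] e; split; first by apply: sM => //; apply: sV.
  by move=> t' [Pt' [<-|ht]]; rewrite opM; [rewrite -e -opM gmulV op1|rewrite hb // opV // ha].
have [sK hK] := key l; split; first exact: hsub.
have [l' hl'] := hK; exists l' => g; have [a [ha [h1 h2]]] := hl' g.
by exists a; split=> //; split=> // t Pt; apply: h2; split=> //; apply: hl.
Qed.

Lemma gpow_conj (a b : G) n : gpow (a ** b ** ginv a) n = a ** gpow b n ** ginv a.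
Proof.
elim: n => [|n IH] /=; first by rewrite gmul1r gVmul.
by rewrite IH !gmulA gmulVK.
Qed.

End FiniteIndex.

Section Commutators.
Variables (G : Group) (H : G -> Prop).
Hypothesis H_sub : subgroup G H.

(** Taken as an intersection, so that membership is itself the induction principle over products of
    commutators. *)
Definition commutator_subgroup (g : G) : Prop :=
  forall K, subgroup G K ->
    (forall a b, H a -> H b -> K (ginv a ** ginv b ** (a ** b))) -> K g.

Local Notation N := commutator_subgroup.

Lemma commutator_sub g : N g -> H g.
Proof.
have [s1 [sM sV]] := H_sub; apply=> //.
by move=> a b Ha Hb; exact: sM (sM _ _ (sV _ Ha) (sV _ Hb)) (sM _ _ Ha Hb).
Qed.

Lemma commutator_in a b : H a -> H b -> N (ginv a ** ginv b ** (a ** b)).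
Proof. by move=> Ha Hb K hK; apply. Qed.

Lemma commutator_is_subgroup : subgroup G N.
Proof.
split; first by move=> L [].
split=> [a b ha hb L hL hS|a ha L hL hS]; have [_ [hM hV]] := hL.
  by apply: (hM); [apply: ha|apply: hb].
by apply: hV; apply: ha.
Qed.

Lemma commutator_normal g c : H g -> N c -> N (ginv g ** c ** g).
Proof.
move=> Hg Nc; have [_ [nM _]] := commutator_is_subgroup.
have -> : ginv g ** c ** g = c ** (ginv c ** ginv g ** (c ** g)).
  by rewrite !gmulA gVmul gmul1.
by apply: (nM) => //; apply: commutator_in => //; apply: commutator_sub.
Qed.

End Commutators.

(** * Medians, gates and separation *)

Section Space.
Variables (X : Type) (d : X -> X -> R).
Hypothesis HX : median_space X d.
Local Notation I := (interval X d).

Lemma dist_ge0 x y : 0 <= d x y.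
Proof. by apply HX. Qed.

Lemma dist_eq0 x y : d x y <= 0 -> x = y.
Proof. move=> h; apply HX; have := dist_ge0 x y; lra. Qed.

Lemma dist_xx x : d x x = 0.
Proof. by apply HX. Qed.

Lemma dist_sym x y : d x y = d y x.
Proof. by apply HX. Qed.

Lemma dist_tri x y z : d x z <= d x y + d y z.
Proof. by apply HX. Qed.

Ltac known_sym d a b :=
  match goal with
  | _ : d a b = d b a |- _ => idtac
  | _ : d b a = d a b |- _ => idtac
  end.

Ltac metric :=
  intros; unfold interval in *;
  repeat match goal with
    | H : context [d ?a ?b] |- _ =>
        tryif known_sym d a b then fail else
        (pose proof (dist_sym a b); pose proof (dist_ge0 a b))
    | |- context [d ?a ?b] =>
        tryif known_sym d a b then fail else
        (pose proof (dist_sym a b); pose proof (dist_ge0 a b))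
    end;
    repeat match goal with
    | H : context [d ?a ?a] |- _ => rewrite (dist_xx a) in H
    | |- context [d ?a ?a] => rewrite (dist_xx a)
    end; lra.

Definition med (x y z : X) : X :=
  epsilon (inhabits x) (fun m => I x y m /\ I y z m /\ I z x m).

Lemma medP x y z : I x y (med x y z) /\ I y z (med x y z) /\ I z x (med x y z).
Proof.
rewrite /med; apply epsilon_spec.
by case: HX => _ /(_ x y z) [m [hm _]]; exists m.
Qed.

Lemma med_eq x y z m : I x y m -> I y z m -> I z x m -> med x y z = m.
Proof.
move=> h1 h2 h3; case: HX => _ /(_ x y z) [m' [_ hu]].
by rewrite -(hu m) // -(hu (med x y z)) //; apply: medP.
Qed.

Lemma int_sym x y z : I x y z -> I y x z.
Proof. move=> h; metric. Qed.

Lemma int_left x y : I x y x.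
Proof. metric. Qed.

Lemma int_right x y : I x y y.
Proof. metric. Qed.

Lemma int_xx x y : I x x y -> y = x.
Proof. move=> h; apply: dist_eq0; metric. Qed.

Lemma int_antisym a x y : I a x y -> I a y x -> x = y.
Proof. move=> h1 h2; apply: dist_eq0; metric. Qed.

Lemma int_trans x y z w : I x y z -> I x z w -> I x y w.
Proof. move=> h1 h2; have := dist_tri x w y; have := dist_tri w z y; metric. Qed.

Lemma int_trans_r x y z w : I x y z -> I x z w -> I w y z.
Proof. move=> h1 h2; have := dist_tri x w y; have := dist_tri w z y; metric. Qed.

Lemma med_swap x y z : med x y z = med y x z.
Proof. by apply: med_eq; have [h1 [h2 h3]] := medP y x z; apply: int_sym. Qed.

Lemma med_rot x y z : med x y z = med y z x.
Proof. by apply: med_eq; have [h1 [h2 h3]] := medP y z x. Qed.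

Lemma med_swap_r x y z : med x y z = med x z y.
Proof. by rewrite (med_rot x z y) (med_swap z y x) (med_rot x y z). Qed.

Lemma med_int1 x y z : I x y (med x y z).
Proof. by case: (medP x y z). Qed.

Lemma med_int2 x y z : I y z (med x y z).
Proof. by case: (medP x y z) => _ []. Qed.

Lemma med_int3 x y z : I x z (med x y z).
Proof. by apply: int_sym; case: (medP x y z) => _ []. Qed.

Lemma med_of_int x y z : I x y z -> med x y z = z.
Proof. by move=> h; apply: med_eq => //; [apply: int_right | apply: int_left]. Qed.

Lemma med_convex C x y z : convex X d C -> C x -> C y -> C (med x y z).
Proof. by move=> hC hx hy; apply: (hC x y) => //; apply: med_int1. Qed.

Lemma med_convex2 C x y z : convex X d C -> C y -> C z -> C (med x y z).
Proof. by rewrite med_rot; apply: med_convex. Qed.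

Lemma med_convex3 C x y z : convex X d C -> C x -> C z -> C (med x y z).
Proof. by rewrite med_swap_r; apply: med_convex. Qed.

Definition gate (C : X -> Prop) (z c : X) : Prop := C c /\ forall w, C w -> I z w c.

(** For [w] between [x] and [y], triangle inequalities along [x], [a], [b], [y] force [e] to be the
    median of [x], [y], [z], and by construction [e] lies between [z] and [w]. Convexity of
    intervals is deduced from this afterwards. *)
Lemma gate_int x y z : gate (I x y) z (med x y z).
Proof.
split; first exact: med_int1.
move=> w hw; set a := med z w x; set b := med z w y; set e := med a b z.
have ha1 : I z w a := med_int1 z w x.
have ha2 : I w x a := med_int2 z w x.
have ha3 : I z x a := med_int3 z w x.
have hb1 : I z w b := med_int1 z w y.
have hb2 : I w y b := med_int2 z w y.
have hb3 : I z y b := med_int3 z w y.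
have he1 : I a b e := med_int1 a b z.
have he2 : I b z e := med_int2 a b z.
have he3 : I a z e := med_int3 a b z.
have t1 := dist_tri a w b; have t2 := dist_tri x a y; have t3 := dist_tri a b y.
have t4 := dist_tri x a e; have t5 := dist_tri e b y; have t6 := dist_tri x e y.
have t7 := dist_tri x e z; have t8 := dist_tri y e z; have t9 := dist_tri y b e.
have -> : med x y z = e by apply: med_eq; metric.
by apply: (int_trans _ _ a) => //; apply: int_sym.
Qed.

Lemma int_convex x y : convex X d (I x y).
Proof.
move=> u v t hu hv ht.
have [hm hg] := gate_int x y t.
have h1 := hg u hu; have h2 := hg v hv.
have -> // : t = med x y t.
have := dist_tri u (med x y t) v; move=> h3; apply: dist_eq0; metric.
Qed.

Lemma gate_dist_le C z c w : gate C z c -> C w -> d z c <= d z w.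
Proof. by move=> [_ h] /h hw; metric. Qed.

Lemma gate_between C z c t : gate C z c -> I z c t -> gate C t c.
Proof. by move=> [h1 h2] ht; split=> // w hw; apply: (int_trans_r z) => //; apply: h2. Qed.

Lemma gate_lip C z c z' c' : gate C z c -> gate C z' c' -> d c c' <= d z z'.
Proof.
move=> [h1 h2] [h3 h4]; have := h2 _ h3; have := h4 _ h1.
have := dist_tri z z' c'; have := dist_tri z' z c; move=> *; metric.
Qed.

Lemma med_lip x y z z' : d (med x y z) (med x y z') <= d z z'.
Proof. by apply: (gate_lip (I x y)); apply: gate_int. Qed.

(** In the order based at [q] the point [med q u v] is the meet of [u] and [v], and [r] is a common
    lower bound. The median of [r], [u], [v] turns out to be this meet. *)
Lemma int_med q u v r : I q u r -> I q v r -> I q (med q u v) r.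
Proof.
move=> h1 h2; set r1 := med r u v.
have a1 : I r u r1 := med_int1 r u v.
have a2 : I u v r1 := med_int2 r u v.
have a3 : I r v r1 := med_int3 r u v.
have -> : med q u v = r1.
  apply: med_eq => //.
    by have := dist_tri q r r1; have := dist_tri q r1 u; move=> *; metric.
  by have := dist_tri q r r1; have := dist_tri q r1 v; move=> *; metric.
by have := dist_tri q r r1; have := dist_tri q r1 v; move=> *; metric.
Qed.

(** Projections preserve betweenness. The point [e] is the median of [u], [v], [t'] and still has
    gate [t']. The median [r] of the three gates lies between [t'] and [e], while the gate [t'] lies
    between [e] and [r]; hence [r = t']. *)
Lemma gate_morph C u v t u' v' t' : convex X d C ->
  gate C u u' -> gate C v v' -> gate C t t' -> I u v t -> I u' v' t'.
Proof.
move=> hC gu gv gt ht.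
set a := med u t t'; set b := med v t t'; set e := med a b t'.
have a1 : I u t a := med_int1 u t t'.
have a2 : I t t' a := med_int2 u t t'.
have a3 : I u t' a := med_int3 u t t'.
have b1 : I v t b := med_int1 v t t'.
have b2 : I t t' b := med_int2 v t t'.
have b3 : I v t' b := med_int3 v t t'.
have e1 : I a b e := med_int1 a b t'.
have e2 : I b t' e := med_int2 a b t'.
have e3 : I a t' e := med_int3 a b t'.
have ge : gate C e t'.
  by apply: (gate_between _ t) => //; apply: (int_convex t t' a t') => //; apply: int_right.
have ha : I u v a by apply: (int_trans _ _ t).
have hb : I u v b by apply/int_sym/(int_trans _ _ t) => //; apply: int_sym.
have hm : med u v t' = e.
  apply: med_eq; first exact: (int_convex u v a b).
    apply: (int_convex v t' b t') => //; exact: int_right.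
  by apply/int_sym/(int_convex u t' a t') => //; apply: int_right.
set r := med t' u' v'.
have Cr : I u' v' r := med_int2 t' u' v'.
have r1 : I t' u' r := med_int1 t' u' v'.
have r2 : I t' v' r := med_int3 t' u' v'.
have [Cu hu] := gu; have [Cv hv] := gv; have [Ct hgt] := gt.
have q1 : I t' u r by apply: (int_trans _ _ u') => //; apply/int_sym/hu.
have q2 : I t' v r by apply: (int_trans _ _ v') => //; apply/int_sym/hv.
have q3 : I t' e r by rewrite -hm med_rot med_rot; apply: int_med.
have q4 : I e r t' by apply: (proj2 ge); apply: (hC u' v').
suff -> : t' = r by [].
apply: dist_eq0; metric.
Qed.

Definition cl (C : X -> Prop) (x : X) : Prop := forall e, 0 < e -> exists2 y, C y & d x y < e.

Definition closed (C : X -> Prop) : Prop := forall x, cl C x -> C x.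

Lemma cl_sub (C : X -> Prop) x : C x -> cl C x.
Proof. by move=> h e he; exists x => //; rewrite dist_xx. Qed.

Lemma cl_mono (C D : X -> Prop) x : (forall y, C y -> D y) -> cl C x -> cl D x.
Proof. by move=> h hx e /hx [y hy ?]; exists y; auto. Qed.

Lemma cl_closed C : closed (cl C).
Proof.
move=> x hx e he; have [|y hy hxy] := hx (e / 2); first lra.
have [|z hz hyz] := hy (e / 2); first lra.
by exists z => //; have := dist_tri x y z; lra.
Qed.

Lemma cl_convex C : convex X d C -> convex X d (cl C).
Proof.
move=> hC x y z hx hy hz e he.
have [|x' Cx hx'] := hx (e / 2); first lra.
have [|y' Cy hy'] := hy (e / 2); first lra.
exists (med x' y' z); first exact: med_convex.
rewrite -{1}(med_of_int _ _ _ hz).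
have := dist_tri (med x y z) (med x' y z) (med x' y' z).
have := med_lip y z x x'; have := med_lip x' z y y'.
rewrite -(med_rot x y z) -(med_rot x' y z) (med_swap_r x' z y) (med_swap_r x' z y'); lra.
Qed.

Lemma closed_int x y : closed (I x y).
Proof.
move=> z hz; have -> : z = med x y z; last exact: med_int1.
apply: dist_eq0; apply: le_epsilon => e he.
have [|w hw hzw] := hz (e / 2); first lra.
have := med_lip x y z w; rewrite (med_of_int _ _ w) // => h.
have := dist_tri z w (med x y z); have := dist_sym w (med x y z); lra.
Qed.

Lemma closed_point a : closed (eq a).
Proof.
move=> x hx; symmetry; apply: dist_eq0; apply: le_epsilon => e he.
by have [y <- h] := hx e he; lra.
Qed.

Lemma convex_point a : convex X d (eq a).
Proof. by move=> x y z <- <- h; symmetry; apply: int_xx h. Qed.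

Lemma convex_and (C D : X -> Prop) : convex X d C -> convex X d D -> convex X d (fun x => C x /\ D x).
Proof. by move=> h1 h2 x y z [? ?] [? ?] hz; split; [apply: h1 hz|apply: h2 hz]. Qed.

Hypothesis HC : complete X d.

(** Read [P x t] as: [x] approximates the limit with error [t]. This is the only form in which
    completeness enters, for gates, meets and descending orbits alike. *)
Lemma net_limit (P : X -> R -> Prop) :
  (forall e, 0 < e -> exists x t, P x t /\ t < e) ->
  (forall x y t s, P x t -> P y s -> d x y <= t + s) ->
  exists u, forall x t, P x t -> d x u <= t.
Proof.
move=> hP hd.
have hu n : exists xt, P (fst xt) (snd xt) /\ snd xt < / INR (S n).
  have [|x [t ht]] := hP (/ INR (S n)); last by exists (x, t).
  by apply: Rinv_0_lt_compat; apply: lt_0_INR; lia.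
pose u n := fst (proj1_sig (constructive_indefinite_description _ (hu n))).
pose t n := snd (proj1_sig (constructive_indefinite_description _ (hu n))).
have hut n : P (u n) (t n) /\ t n < / INR (S n).
  exact: (proj2_sig (constructive_indefinite_description _ (hu n))).
have hinv e : 0 < e -> exists N, forall n, (N <= n)%nat -> t n < e.
  move=> he; have [N [hN hN0]] := archimed_cor1 e he; exists N => n hn.
  apply: Rlt_le_trans (proj2 (hut n)) _; apply: Rle_trans (Rlt_le _ _ hN).
  by apply: Rinv_le_contravar; [exact: lt_0_INR|apply: le_INR; lia].
have [|c hc] := HC u.
  move=> e he; have [|N hN] := hinv (e / 2); first lra.
  exists N => p q /hN hp /hN hq.
  have := hd _ _ _ _ (proj1 (hut p)) (proj1 (hut q)); lra.
exists c => x s hx; apply: le_epsilon => e he.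
have [|N hN] := hc (e / 2); first lra.
have [|M hM] := hinv (e / 2); first lra.
have h1 := hN _ (Nat.le_max_l N M); have h2 := hM _ (Nat.le_max_r N M).
have := hd _ _ _ _ hx (proj1 (hut (max N M))).
have := dist_tri x (u (max N M)) c; lra.
Qed.

(** Two almost nearest points [x], [y] are close, because [med z x y] is again in [C] and cannot be
    nearer to [z] than the infimum. The same remark applied to the limit and [w] gives the gate
    property. *)
Lemma gate_ex C z : convex X d C -> closed C -> (exists x, C x) -> exists c, gate C z c.
Proof.
move=> hC hcl [x0 Cx0].
have [||m [hm happ]] := infimum (fun t => exists2 c, C c & t = d z c).
- by exists (d z x0), x0.
- by move=> t [c _ ->]; apply: dist_ge0.
have hle c : C c -> m <= d z c by move=> hc; apply: hm; exists c.
have hnear c c' : C c -> C c' -> d z (med z c c') + d (med z c c') c = d z c /\ m <= d z (med z c c').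
  by move=> h h'; split; [apply: med_int1|apply: hle; apply: med_convex2].
have [||c hc] := net_limit (fun x t => C x /\ t = d z x - m).
- move=> e he; have [t [[x Cx ->] hx]] := happ e he.
  by exists x, (d z x - m); split=> //; lra.
- move=> x y t s [Cx ->] [Cy ->].
  have [h1 h2] := hnear _ _ Cx Cy; have [h3 h4] := hnear _ _ Cy Cx.
  rewrite med_swap_r in h3 h4.
  have := dist_tri x (med z x y) y; have := dist_sym x (med z x y); lra.
have hcx x : C x -> d x c <= d z x - m by move=> Cx; apply: hc.
have Cc : C c.
  apply: hcl => e he; have [t [[x Cx ->] hx]] := happ e he.
  by exists x => //; have := hcx x Cx; rewrite dist_sym; lra.
have dc : d z c <= m.
  apply: le_epsilon => e he; have [|t [[x Cx ->] hx]] := happ (e / 2); first lra.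
  have := hcx x Cx; have := dist_tri z x c; lra.
exists c; split=> // w Cw.
have [h1 h2] := hnear _ _ Cc Cw.
have -> : c = med z c w; last exact: med_int3.
symmetry; apply: dist_eq0; lra.
Qed.

(* Choose [c = med c1 c2 t] and project everything to [I t x]: there the projection of [c] is [t]. *)
Lemma join_point_convex C x : convex X d C -> convex X d (fun z => exists2 c, C c & I c x z).
Proof.
move=> hC p1 p2 t [c1 C1 h1] [c2 C2 h2] ht.
exists (med c1 c2 t); first exact: med_convex.
have gm z : gate (I t x) z (med t x z) by apply: gate_int.
have cI := int_convex t x.
have q1 := gate_morph _ _ _ _ _ _ _ cI (gm c1) (gm x) (gm p1) h1.
have q2 := gate_morph _ _ _ _ _ _ _ cI (gm c2) (gm x) (gm p2) h2.
have q3 := gate_morph _ _ _ _ _ _ _ cI (gm p1) (gm p2) (gm t) ht.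
rewrite (med_of_int t x t (int_left _ _)) in q3.
rewrite (med_of_int t x x (int_right _ _)) in q1 q2.
have r1 := med_int1 t x c1; have r2 := med_int1 t x c2.
have r3 := med_int1 t x p1; have r4 := med_int1 t x p2.
have q4 : I (med t x c1) (med t x c2) t.
  have := dist_tri (med t x c1) t (med t x c2).
  have := dist_tri (med t x p1) (med t x c1) (med t x p2).
  have := dist_tri (med t x c1) (med t x c2) (med t x p2).
  have := dist_tri (med t x p1) (med t x c1) t; have := dist_tri (med t x p2) (med t x c2) t.
  metric.
set c := med c1 c2 t.
have [c12 [c2t ct1]] := medP c1 c2 t; rewrite -/c in c12 c2t ct1.
have p12 := gate_morph _ _ _ _ _ _ _ cI (gm c1) (gm c2) (gm c) c12.
have p2t := gate_morph _ _ _ _ _ _ _ cI (gm c2) (gm t) (gm c) c2t.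
have pt1 := gate_morph _ _ _ _ _ _ _ cI (gm t) (gm c1) (gm c) ct1.
rewrite (med_of_int t x t (int_left _ _)) in p2t pt1.
have e : med t x c = t.
  by rewrite -(med_eq _ _ _ _ p12 p2t pt1) med_of_int.
by have := med_int2 t x c; rewrite e; apply: int_sym.
Qed.

(** A Pasch property. Project everything to the interval from [z] to [w]: both [b1] and [b2] go to
    [w], and the median [j] of [w] with the projections of [c1] and [c2], which lies in [C], is
    forced to equal [w]. *)
Lemma pasch C x y z c1 c2 b1 b2 : convex X d C -> C z -> C c1 -> C c2 ->
  I x y z -> I c1 x b1 -> I c2 y b2 -> C (med b1 b2 z).
Proof.
move=> hC Cz C1 C2 hz h1 h2; set w := med b1 b2 z.
have w2 : I b2 z w := med_int2 b1 b2 z.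
have w3 : I b1 z w := med_int3 b1 b2 z.
have gm t : gate (I z w) t (med z w t) by apply: gate_int.
have cI := int_convex z w.
have q1 := gate_morph _ _ _ _ _ _ _ cI (gm c1) (gm x) (gm b1) h1.
have q2 := gate_morph _ _ _ _ _ _ _ cI (gm c2) (gm y) (gm b2) h2.
have q3 := gate_morph _ _ _ _ _ _ _ cI (gm x) (gm y) (gm z) hz.
have e1 : med z w b1 = w.
  by rewrite med_swap_r; apply: med_of_int; apply: int_sym.
have e2 : med z w b2 = w.
  by rewrite med_swap_r; apply: med_of_int; apply: int_sym.
rewrite (med_of_int z w z (int_left _ _)) in q3.
rewrite e1 in q1; rewrite e2 in q2.
have a1 := med_int1 z w c1; have a2 := med_int1 z w c2.
have k1 : C (med z w c1) by apply: (hC z c1) => //; apply: med_int3.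
have k2 : C (med z w c2) by apply: (hC z c2) => //; apply: med_int3.
have a3 := med_int1 z w x; have a4 := med_int1 z w y.
move: q1 q2 q3 a1 a2 a3 a4 k1 k2.
move: (med z w c1) (med z w c2) (med z w x) (med z w y) => c1' c2' x' y' q1 q2 q3 a1 a2 a3 a4 k1 k2.
set j := med c1' c2' w.
have j1 : I c1' c2' j := med_int1 c1' c2' w.
have j2 : I c2' w j := med_int2 c1' c2' w.
have j3 : I c1' w j := med_int3 c1' c2' w.
have jz : I z w j by apply: (cI c1' c2').
have s1 : I j x' w by apply: (int_trans_r c1' x' w j).
have s2 : I j y' w by apply: (int_trans_r c2' y' w j).
have s3 := int_med _ _ _ _ s1 s2.
have [g1 g2] := gate_int x' y' j.
have s4 : I j z (med j x' y') by rewrite med_rot; apply: g2.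
have s5 : I j z w by apply: (int_trans _ _ (med j x' y')).
have -> : w = j by apply: dist_eq0; metric.
exact: (hC c1' c2').
Qed.

(** Take [C] maximal among the convex sets that contain [A] and avoid [B]. A point outside [C] has a
    point of [B] between it and [C], since joining it to [C] must hit [B]; [pasch] then forbids a
    point of [C] between two outside points. *)
Lemma convex_separation A B : convex X d A -> convex X d B -> (forall x, A x -> B x -> False) ->
  exists h, convex X d h /\ convex X d (fun x => ~ h x) /\ (forall x, A x -> h x) /\
    (forall x, B x -> ~ h x).
Proof.
move=> hA hB hAB.
pose P C := convex X d C /\ forall x, C x -> B x -> False.
have [|F [S0 FS0] hF htot|C [[hC CB] [AC hmax]]] := zorn_above P A; first by split.
  split; last by move=> x [S /hF [_ h] hS]; apply: h hS.
  move=> x y z [S1 F1 h1] [S2 F2 h2] hz.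
  have [c1 _] := hF _ F1; have [c2 _] := hF _ F2.
  by case: (htot _ _ F1 F2) => h; [exists S2 => //; apply: (c2 x y); auto
                                  |exists S1 => //; apply: (c1 x y); auto].
exists C; split=> //; split; last by split=> // x Bx Cx; apply: CB Bx.
case: (classic (exists c0, C c0)) => [[c0 C0]|hE]; last first.
  by move=> x y z _ _ _ Cz; apply: hE; exists z.
have key x : ~ C x -> exists c b, C c /\ B b /\ I c x b.
  move=> nx; apply: NNPP => hn; apply: nx.
  apply: (hmax (fun z => exists2 c, C c & I c x z)).
  - split; first exact: join_point_convex.
    by move=> b [c Cc hb] Bb; apply: hn; exists c, b.
  - by move=> z Cz; exists z => //; apply: int_left.
  - by exists c0 => //; apply: int_right.
move=> x y z /key [c1 [b1 [C1 [B1 h1]]]] /key [c2 [b2 [C2 [B2 h2]]]] hz Cz.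
apply: (CB (med b1 b2 z)); first exact: (pasch C x y z c1 c2).
exact: med_convex.
Qed.

Variable r : nat.
Hypothesis Hr : forall f : nat -> X -> Prop, (forall i, (i <= r)%nat -> halfspace X d (f i)) ->
  (forall i j, (i < j <= r)%nat -> transverse X (f i) (f j)) -> False.

(** * Consequences of finite rank *)

(* The join of [l] in the interval from [a] to [z], seen as a lattice with bottom [a], top [z]. *)
Definition join (z a : X) (l : list X) : X := fold_right (fun u v => med u v z) a l.

Lemma join_convex C z a l : convex X d C -> C a -> (forall u, In u l -> C u) -> C (join z a l).
Proof.
move=> hC Ca; elim: l => [//|u l IH] hl /=.
by apply: med_convex => //; [apply: hl; left|apply: IH => v hv; apply: hl; right].
Qed.

Lemma join_int z a l : (forall u, In u l -> I a z u) -> I a z (join z a l).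
Proof. by move=> hl; apply: join_convex => //; [apply: int_convex|apply: int_left]. Qed.

Lemma join2_ub a z u v : I a z u -> I a (med u v z) u.
Proof.
move=> hu; apply: int_sym; apply: (int_trans_r z a u); first exact: int_sym.
by apply: int_sym; apply: med_int3.
Qed.

Lemma join_ub a z l u : (forall v, In v l -> I a z v) -> In u l -> I a (join z a l) u.
Proof.
elim: l => [//|v l IH] hl /= [<-|hu]; first by apply: join2_ub; apply: hl; left.
have hl' w : In w l -> I a z w by move=> hw; apply: hl; right.
apply: (int_trans a _ (join z a l)); last exact: IH.
by rewrite med_swap; apply: join2_ub; apply: (join_int z a l).
Qed.

Definition dsum (a : X) (l : list X) : R := fold_right (fun u s => d a u + s) 0 l.

Lemma dsum_le a l b : (forall u, In u l -> d a u <= b) -> dsum a l <= INR (length l) * b.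
Proof.
elim: l => [|u l IH] h; first by rewrite /dsum /=; lra.
have h1 := h u (or_introl eq_refl).
have := IH (fun v hv => h v (or_intror hv)).
by rewrite (S_INR (length l) : INR (length (u :: l)) = _) /dsum /= -/(dsum a l); lra.
Qed.

Lemma join_dist a z l : (forall v, In v l -> I a z v) -> d a (join z a l) <= dsum a l.
Proof.
elim: l => [_|u l IH hl] /=; first by rewrite dist_xx; lra.
have hl' w : In w l -> I a z w by move=> hw; apply: hl; right.
have {}IH := IH hl'; have hu := hl u (or_introl eq_refl).
have := med_lip u z a (join z a l).
rewrite (med_swap_r u z a) (med_rot u a z) (med_of_int a z u) // (med_swap_r u z).
have := dist_tri a u (med u (join z a l) z); lra.
Qed.

Lemma join_app_dist a z l1 l2 : (forall v, In v (l1 ++ l2) -> I a z v) ->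
  d (join z a l1) (join z a (l1 ++ l2)) <= dsum a l2.
Proof.
elim: l1 => [|u l IH] hl /=; first exact: join_dist.
apply: Rle_trans (IH _); last by move=> v hv; apply: hl; right.
rewrite !(med_swap_r u _ z); exact: med_lip.
Qed.

(* If no element could be dropped, separating each element from the join of the others would give
   [r + 1] pairwise transverse halfspaces. *)
Lemma irredundant a z l : (forall v, In v l -> I a z v) -> (r < length l)%nat ->
  exists l1 u l2, l = l1 ++ u :: l2 /\ I a (join z a (l1 ++ l2)) u.
Proof.
move=> hl hlen; apply: NNPP => hn.
have hsep i : exists h, (i <= r)%nat ->
    halfspace X d h /\ ~ h a /\ h z /\ h (nth i l a) /\
    forall j, (j <= r)%nat -> j <> i -> ~ h (nth j l a).
  case: (le_lt_dec i r) => hi; last by exists (fun _ => True); lia.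
  have [|l1 [l2 [e hl1]]] := nth_split (n := i) l a; first lia.
  have hl' v : In v (l1 ++ l2) -> I a z v.
    by move=> hv; apply: hl; rewrite e; apply: in_or_app; case: (in_app_or _ _ _ hv); [left|right; right].
  have [||x <- hx|h [ch [ch' [h1 h2]]]] := convex_separation (eq (nth i l a)) (I a (join z a (l1 ++ l2))).
  - exact: convex_point.
  - exact: int_convex.
  - by apply: hn; exists l1, (nth i l a), l2.
  have ha : ~ h a by apply/h2/int_left.
  have hi' : h (nth i l a) by apply: h1.
  exists h => _; split; last split=> //; last split.
  - by split; [exists (nth i l a)|split; [exists a|]].
  - apply: NNPP => hz; apply: (ch' a z (nth i l a)) => //; apply: hl; apply: nth_In; lia.
  split=> // j hj hji; apply/h2/join_ub => //.
  rewrite e; case: (le_lt_dec i j) => hij; last first.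
    by rewrite app_nth1; [apply: in_or_app; left; apply: nth_In; lia|lia].
  rewrite app_nth2 ?hl1; last lia.
  have -> : (j - i = S (j - S i))%nat by lia.
  apply: in_or_app; right; rewrite /=; apply: nth_In.
  have : length l = length (l1 ++ nth i l a :: l2) by rewrite -e.
  rewrite length_app /=; lia.
pose f i := proj1_sig (constructive_indefinite_description _ (hsep i)).
have hf i (hi : (i <= r)%nat) := proj2_sig (constructive_indefinite_description _ (hsep i)) hi.
rewrite -/(f _) in hf.
apply: (Hr f) => [i /hf [] //|i j hij].
have [_ [ia [iz [ii hi]]]] := hf i ltac:(lia).
have [_ [ja [jz [jj hj]]]] := hf j ltac:(lia).
split; first by exists z.
split; first by exists (nth i l a); split=> //; apply: hj; lia.
split; last by exists a.
by exists (nth j l a); split=> //; apply: hi; lia.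
Qed.

Lemma short_join a z (S : X -> Prop) l : (forall v, S v -> I a z v) -> (forall v, In v l -> S v) ->
  join z a l = z ->
  exists l', (forall v, In v l' -> S v) /\ join z a l' = z /\ (length l' <= r)%nat.
Proof.
move=> hS; elim: {l}(length l) {-2}l (Nat.le_refl (length l)) => [|n IH] l hn hl e.
  by exists l; split=> //; split=> //; lia.
case: (le_lt_dec (length l) r) => hlen; first by exists l.
have [|l1 [u [l2 [e' hu]]]] := irredundant a z l _ hlen; first by move=> v /hl /hS.
have hl' v : In v (l1 ++ l2) -> S v.
  by move=> hv; apply: hl; rewrite e'; apply: in_or_app; case: (in_app_or _ _ _ hv); [left|right; right].
apply: (IH (l1 ++ l2)) => //.
  by move: hn; rewrite e' !length_app /=; lia.
apply: (int_antisym a); last by apply: join_int => v /hl' /hS.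
rewrite -{2}e; apply: join_convex; [exact: int_convex|exact: int_left|].
move=> v; rewrite e' => hv; case: (in_app_or _ _ _ hv) => [hv1|[<- //|hv2]].
  by apply: join_ub => [w /hl' /hS //|]; apply: in_or_app; left.
by apply: join_ub => [w /hl' /hS //|]; apply: in_or_app; right.
Qed.

(* Seen from the gate [a] of [z] in [C], the point [z] is a join of at most [r] of the projections
   [med a z s] with [s] in the neighbourhood, and each of these is at distance at most [rho] from [a]. *)
Lemma hull_nbhd C rho z : convex X d C -> closed C -> (exists x, C x) -> 0 <= rho ->
  (forall D, convex X d D -> (forall x c, C c -> d c x <= rho -> D x) -> D z) ->
  exists2 c, C c & d c z <= INR r * rho.
Proof.
move=> hC hcl hne hrho hull.
have [a [Ca ga]] := gate_ex C z hC hcl hne.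
exists a => //.
pose S v := exists s c, C c /\ d c s <= rho /\ v = med a z s.
pose W w := exists2 l, (forall v, In v l -> S v) & I a (join z a l) w.
have SI v : S v -> I a z v by move=> [s [c [_ [_ ->]]]]; apply: med_int1.
have WC : convex X d W.
  move=> w1 w2 w [l1 h1 k1] [l2 h2 k2] hw.
  have hl v : In v (l1 ++ l2) -> S v by move=> /(in_app_or _ _ _) [/h1|/h2].
  exists (l1 ++ l2) => //.
  have sub l l' : (forall v, In v l -> S v) -> (forall v, In v l' -> S v) -> incl l l' ->
      forall w', I a (join z a l) w' -> I a (join z a l') w'.
    move=> hl1 hl2 hi w' hw'; apply: (int_trans a _ (join z a l)) => //.
    apply: join_convex; [exact: int_convex|exact: int_left|].
    by move=> u /hi hu; apply: join_ub => // v /hl2 /SI.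
  apply: (int_convex a _ w1 w2) => //.
    by apply: (sub l1) => // u hu; apply: in_or_app; left.
  by apply: (sub l2) => // u hu; apply: in_or_app; right.
case: (classic (W z)) => [[l hl hz]|nW].
  have e : join z a l = z.
    by apply: (int_antisym a) => //; apply: join_int => v /hl /SI.
  have [l' [hl' [e' hlen]]] := short_join a z S l SI hl e.
  rewrite -{1}e'; apply: Rle_trans; first by apply: join_dist => v /hl' /SI.
  apply: Rle_trans (dsum_le _ _ rho _) _; last first.
    by apply: Rmult_le_compat_r => //; apply: le_INR.
  move=> u /hl' [s [c [Cc [hs ->]]]].
  have : med a z c = a by rewrite med_rot; apply: med_of_int; apply: ga.
  by have := med_lip a z c s => h e1; rewrite e1 in h; lra.
(* Outside [W], the point [z] is cut off by some [h]. A point [x] of the neighbourhood in [h] would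
   put [med a z x] into both [h] and [W], so the complement of [h] contains the neighbourhood but
   not [z], against [hull]. *)
have [||x <- //|h [ch [ch' [hz hW]]]] := convex_separation (eq z) W.
- exact: convex_point.
- exact: WC.
case: (hull (fun x => ~ h x)) => //; last exact: hz.
move=> x c Cc hx hxh; apply: (hW (med a z x)).
  exists (med a z x :: nil); first by move=> v [<-|[]]; exists x, c.
  by apply: join_ub => [v [<-|[]]|]; [apply: med_int1|left].
by apply: med_convex2 => //; apply: hz.
Qed.

Definition far (rho : R) (A B : X -> Prop) : Prop := forall a b, A a -> B b -> rho <= d a b.

(** By [hull_nbhd] the hulls of the [rho]-neighbourhoods of [C] and of [p] stay within [r * rho] of
    [C] and [p]; hence the factor [2 * r], which makes them disjoint. *)
Lemma thick_separation C rho p : convex X d C -> closed C -> (exists x, C x) -> 0 < rho ->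
  (forall c, C c -> 2 * INR r * rho < d c p) ->
  exists h, halfspace X d h /\ far rho C h /\ forall x, d p x <= rho -> h x.
Proof.
move=> hC hcl [c0 C0] hrho hp.
pose hull (S : X -> Prop) x := forall D, convex X d D -> (forall y, S y -> D y) -> D x.
have hull_convex S : convex X d (hull S).
  by move=> x y z hx hy hz D hD hS; apply: (hD x y z) => //; [apply: hx|apply: hy].
pose A := hull (fun x => exists2 c, C c & d c x <= rho).
pose B := hull (fun x => d p x <= rho).
have [||x hA hB|h [ch [ch' [hA hB]]]] := convex_separation B A; try exact: hull_convex.
  have [|||c Cc h1] := hull_nbhd C rho x hC hcl; first by exists c0.
  - lra.
  - by move=> D cD hD; apply: hB => // y [c Cc hc]; apply: hD hc.
  have [|||||c' <- h2] := hull_nbhd (eq p) rho x.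
  - exact: convex_point.
  - exact: closed_point.
  - by exists p.
  - lra.
  - by move=> D cD hD; apply: hA => // y; apply: hD.
  have := hp c Cc; have := dist_tri c x p; have := dist_sym x p; lra.
have pB x : d p x <= rho -> h x by move=> hx; apply: hA => D _; apply.
have nC c x : C c -> d c x <= rho -> ~ h x.
  by move=> Cc hx; apply: hB => D _; apply; exists c.
exists h; split; last split=> //.
  split; first by exists p; apply: pB; rewrite dist_xx; lra.
  split=> //; exists c0; apply: (nC c0) => //; rewrite dist_xx; lra.
move=> a b Ca hb; apply: Rnot_lt_le => hlt; apply: (nC a b) => //; lra.
Qed.

Lemma halfspace_compl h : halfspace X d h -> halfspace X d (fun x => ~ h x).
Proof.
have e : (fun x => ~ ~ h x) = h by apply: pred_ext => x; split; [apply: NNPP|move=> hx; apply].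
by move=> [[x hx] [hy [h1 h2]]]; split=> //; split; [exists x; apply|rewrite e].
Qed.

Lemma point_separation a b : a <> b -> exists h, halfspace X d h /\
  ~ cl h a /\ ~ cl (fun x => ~ h x) b.
Proof.
move=> hab; have hd : 0 < d a b.
  by apply: Rnot_le_lt => h; apply/hab/dist_eq0.
have hrr : 0 <= INR r by apply: pos_INR.
pose rho := d a b / (2 * INR r + 1).
have hrho : 0 < rho by apply: Rdiv_lt_0_compat; lra.
have e : rho * (2 * INR r + 1) = d a b by rewrite /rho; field; lra.
have [|||||h [hh [h1 h2]]] := thick_separation (eq a) rho b.
- exact: convex_point.
- exact: closed_point.
- by exists a.
- by [].
- by move=> c <-; lra.
exists h; split=> //; split=> hx; have [y hy hlt] := hx rho hrho.
  by have := h1 a y eq_refl hy; lra.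
by apply: hy; apply: h2; lra.
Qed.

(** Alternating projections stabilise after two steps: [v] remains the gate of [u], so [u] and [v]
    are gates of each other and realise the distance. *)
Lemma bridge A B : convex X d A -> closed A -> (exists x, A x) -> convex X d B -> closed B ->
  (exists x, B x) -> exists u v, A u /\ B v /\ forall a b, A a -> B b -> d u v <= d a b.
Proof.
move=> cA clA [u0 Au0] cB clB neB.
have [v [Bv gv]] := gate_ex B u0 cB clB neB.
have [u [Au gu]] := gate_ex A v cA clA (ex_intro _ u0 Au0).
have gv' w : B w -> I u w v.
  by move=> Bw; apply: (int_trans_r u0) (gv w Bw) _; apply/int_sym/gu.
exists u, v; split=> //; split=> // a b Aa Bb.
set a1 := med u a b; set b1 := med v b a1.
have Aa1 : A a1 by apply: med_convex.
have Bb1 : B b1 by apply: med_convex.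
have h1 := gv' _ Bb1; have h2 := gu _ Aa1.
have h3 : I v a1 b1 := med_int3 v b a1.
have h4 : I b a1 b1 := med_int2 v b a1.
have h5 : I a b a1 := med_int2 u a b.
have := dist_tri u a1 b1; metric.
Qed.

Definition compl (h : X -> Prop) : X -> Prop := fun x => ~ h x.

Lemma join_app2 z a l1 u l2 : (forall v, In v (l1 ++ u :: l2) -> I a z v) ->
  d (join z a l1) (join z a (l1 ++ l2)) <= dsum a l2.
Proof.
move=> hl; apply: join_app_dist => v hv; apply: hl; apply: in_or_app.
by case: (in_app_or _ _ _ hv); [left|right; right].
Qed.

(* Points [s i] of the layers [k i \ k (S i)] that approach [p] fast enough form an irredundant
   join of [S r] elements. *)
Lemma chain_bound (k : nat -> X -> Prop) p :
  (forall i, convex X d (k i)) -> (forall i, convex X d (compl (k i))) ->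
  (forall i x, k (S i) x -> k i x) ->
  (forall i, (i <= r)%nat -> exists x, k i x /\ ~ k (S i) x) ->
  ~ k 0%nat p -> cl (k (S r)) p -> False.
Proof.
move=> ck ck' kS wit k0p clp.
have mono i j x : (i <= j)%nat -> k j x -> k i x.
  by elim=> [//|j' hj IH] /kS.
have kp i : ~ k i p by move=> /(mono 0%nat i p) h; apply: k0p; apply: h; lia.
have [b kb _] := clp 1 Rlt_0_1.
have near i e : (i <= r)%nat -> 0 < e -> exists s, I p b s /\ k i s /\ ~ k (S i) s /\ d p s < e.
  move=> hi he; have [z [kz nkz]] := wit i hi.
  have [w kw hw] := clp e he.
  have kiw : k i w by apply: (mono i (S r)) => //; lia.
  have kib : k i b by apply: (mono i (S r)) => //; lia.
  (* The points [b], [w], [z] all lie in [k i], while [p] and [z] are outside [k (S i)], so the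
     double median stays in the layer. It is within [d p w] of [p] because medians are
     1-Lipschitz. *)
  exists (med p b (med p w z)); split; first exact: med_int1.
  split; first by apply: med_convex2 => //; apply: med_convex2.
  split.
    have np := kp (S i).
    by apply: (med_convex3 (compl (k (S i)))) => //; apply: (med_convex3 (compl (k (S i)))).
  have := med_lip p b p (med p w z).
  have -> : med p b p = p by rewrite med_of_int //; apply: int_left.
  have := med_int1 p w z; metric.
(* [l1] collects the points of the layers above [i]; the later points [l2] are chosen so close to
   [p] that they cannot make up for the part of [s] missing in the join of [l1]. *)
have build m : forall i l1 e, (i + m <= S r)%nat -> (forall v, In v l1 -> I p b v /\ ~ k i v) -> 0 < e ->
    exists l2, length l2 = m /\ (forall v, In v l2 -> I p b v) /\ dsum p l2 < e /\
      forall m1 u m2, l2 = m1 ++ u :: m2 -> ~ I p (join b p (l1 ++ m1 ++ m2)) u.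
  elim: m => [|m IH] i l1 e hi hl1 he.
    exists nil; split=> //; split=> //; split; first by rewrite /dsum.
    by move=> [|? ?] u m2.
  have [||s [Is [ks [nks ds]]]] := near i (e / 2); [lia|lra|].
  set J := join b p l1.
  have nkJ : ~ k i J.
    by apply: (join_convex (compl (k i))) => //; [apply: kp|move=> v /hl1 []].
  pose del := d s (med p s J).
  have hdel : 0 < del.
    apply: Rnot_le_lt => /dist_eq0 es; apply: (med_convex3 (compl (k i)) p s J) => //.
      exact: kp.
    by rewrite -es.
  have [|v|| l2 [hlen [hI [hs hsplit]]]] := IH (S i) (l1 ++ s :: nil) (Rmin (e / 2) del).
  - lia.
  - move=> hv; case: (in_app_or _ _ _ hv) => [/hl1 [h1 h2]|[<- //|[]]].
    by split=> // /kS.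
  - by apply: Rmin_pos => //; lra.
  have hI' v : In v (l1 ++ s :: l2) -> I p b v.
    by move=> hv; case: (in_app_or _ _ _ hv) => [/hl1 []|[<-|/hI]].
  exists (s :: l2); split; first by rewrite /= hlen.
  split; first by move=> v [<-|/hI].
  split.
    by have := Rmin_l (e / 2) del; rewrite /dsum /= -/(dsum p l2); lra.
  move=> [|s' m1] u m2 [<- e2]; last first.
    by have := hsplit m1 u m2 e2; rewrite -!app_assoc.
  rewrite /= -e2 => hu.
  have := join_app2 b p l1 s l2 hI'.
  have := med_lip p s J (join b p (l1 ++ l2)).
  rewrite (med_swap_r p s (join _ _ (l1 ++ l2))) (med_of_int _ _ _ hu) -/J.
  have := Rmin_r (e / 2) del; have := dist_sym s (med p s J); rewrite -/del; lra.
have [|v []||l [hlen [hI [_ hsplit]]]] := build (S r) 0%nat nil 1; [lia|lra|].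
have [||l1 [u [l2 [e hu]]]] := irredundant p b l; [by []|lia|].
by apply: (hsplit l1 u l2).
Qed.

(** * Isometries, skewering and distances to convex sets *)

Variables (G : Group) (act : G -> X -> X).
Hypothesis Hact : isometric_action G X d act.

Lemma act1 x : act gone x = x.
Proof. by apply Hact. Qed.

Lemma actM g h x : act (g ** h) x = act g (act h x).
Proof. by apply Hact. Qed.

Lemma act_dist g x y : d (act g x) (act g y) = d x y.
Proof. by apply Hact. Qed.

Lemma actK g x : act (ginv g) (act g x) = x.
Proof. by rewrite -actM gmulV act1. Qed.

Lemma actVK g x : act g (act (ginv g) x) = x.
Proof. by rewrite -actM gVmul act1. Qed.

Lemma act_int g x y z : I (act g x) (act g y) (act g z) <-> I x y z.
Proof. by rewrite /interval !act_dist. Qed.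

Definition tr (g : G) (h : X -> Prop) : X -> Prop := fun x => h (act (ginv g) x).

Lemma tr1 h : tr gone h = h.
Proof. by apply: pred_ext => x; rewrite /tr ginv1 act1. Qed.

Lemma trM g1 g2 h : tr (g1 ** g2) h = tr g1 (tr g2 h).
Proof. by apply: pred_ext => x; rewrite /tr ginvM actM. Qed.

Lemma trK g h : tr (ginv g) (tr g h) = h.
Proof. by rewrite -trM gmulV tr1. Qed.

Lemma trVK g h : tr g (tr (ginv g) h) = h.
Proof. by rewrite -trM gVmul tr1. Qed.

Definition trF (g : G) (F : (X -> Prop) -> Prop) : (X -> Prop) -> Prop := fun k => F (tr (ginv g) k).

Lemma trF1 F : trF gone F = F.
Proof. by apply: pred_ext => k; rewrite /trF ginv1 tr1. Qed.

Lemma trFM a b F : trF (a ** b) F = trF a (trF b F).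
Proof. by apply: pred_ext => k; rewrite /trF ginvM trM. Qed.

Lemma tr_act g (h : X -> Prop) x : h x -> tr g h (act g x).
Proof. by rewrite /tr actK. Qed.

Lemma tr_act_inv g (h : X -> Prop) x : tr g h (act g x) -> h x.
Proof. by rewrite /tr actK. Qed.

Lemma tr_convex g h : convex X d h -> convex X d (tr g h).
Proof. by move=> hh x y z hx hy hz; apply: hh hx hy _; apply/act_int. Qed.

Lemma tr_halfspace g h : halfspace X d h -> halfspace X d (tr g h).
Proof.
move=> [[x hx] [[y hy] [h1 h2]]].
split; first by exists (act g x); apply: tr_act.
split; first by exists (act g y) => /tr_act_inv.
by split; [apply: tr_convex|apply: (tr_convex g (compl h))].
Qed.

Lemma tr_cl g h : cl (tr g h) = tr g (cl h).
Proof.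
apply: pred_ext => x; split=> hx e he; have [y hy hd] := hx e he.
  by exists (act (ginv g) y); rewrite // act_dist.
by exists (act g y); [apply: tr_act|rewrite -(actVK g x) act_dist].
Qed.

Lemma tr_far g rho A B : far rho A B -> far rho (tr g A) (tr g B).
Proof. by move=> h a b ha hb; rewrite -(act_dist (ginv g)); apply: h. Qed.

Lemma tr_mono g (h k : X -> Prop) : (forall x, h x -> k x) -> forall x, tr g h x -> tr g k x.
Proof. by move=> hk x; apply: hk. Qed.

Lemma gpow_decr g (h : X -> Prop) : (forall x, tr g h x -> h x) -> forall m n x, (m <= n)%nat ->
  tr (gpow g n) h x -> tr (gpow g m) h x.
Proof.
move=> hg m n x; elim=> {n} [//|n hn IH] hx; apply: IH.
by apply: (tr_mono _ (tr g h)) => //; rewrite -trM -gpowS_r.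
Qed.

Lemma gpow_strict g (h : X -> Prop) x n : h x -> ~ tr g h x ->
  tr (gpow g n) h (act (gpow g n) x) /\ ~ tr (gpow g (S n)) h (act (gpow g n) x).
Proof.
move=> hx nhx; split; first exact: tr_act.
by rewrite gpowS_r trM => /tr_act_inv.
Qed.

Definition skewers (g : G) (h : X -> Prop) : Prop :=
  (forall x, tr g h x -> h x) /\ exists x, h x /\ ~ tr g h x.

(* Otherwise [cl (compl h)] and the closures of all translates share a point [u]; one of the two
   halves of the chain of translates, or of their complements, then contradicts [chain_bound]. *)
Lemma skewer_thick g h : halfspace X d h -> skewers g h ->
  exists n rho, 0 < rho /\ far rho (compl h) (tr (gpow g n) h).
Proof.
move=> hh [hg [z [hz nhz]]].
(* Twice [S r], so that on either side of the middle translate there remain the [S r] layers needed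
   by [chain_bound]; the half that is used depends on whether the middle translate contains [u]. *)
apply: NNPP => hn; set N := (S r + S r)%nat.
have hh' i := tr_halfspace (gpow g i) _ hh.
have [[x hx] [[y hy] [ch ch']]] := hh.
have [[xN hxN] [_ [cN _]]] := hh' N.
have [|||||| u [v [clu [clv huv]]]] := bridge (cl (compl h)) (cl (tr (gpow g N) h)).
- exact: cl_convex.
- exact: cl_closed.
- by exists y; apply: cl_sub.
- exact: cl_convex.
- exact: cl_closed.
- by exists xN; apply: cl_sub.
have huv0 : d u v <= 0.
  apply: Rnot_lt_le => hpos; apply: hn; exists N, (d u v); split=> // a b ha hb.
  by apply: huv; apply: cl_sub.
move: clv; rewrite -(dist_eq0 _ _ huv0) => {huv huv0} clv.
case: (classic (tr (gpow g (S r)) h u)) => hu.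
  apply: (chain_bound (fun i => compl (tr (gpow g (S r - i)) h)) u).
  - by move=> i; case: (hh' (S r - i)%nat) => _ [_ []].
  - move=> i; rewrite /compl.
    have -> : (fun x => ~ ~ tr (gpow g (S r - i)) h x) = tr (gpow g (S r - i)) h.
      by apply: pred_ext => t; split; [apply: NNPP|move=> ? ?].
    by case: (hh' (S r - i)%nat) => _ [_ []].
  - move=> i t ht ht'; apply: ht; apply: gpow_decr ht' => //; lia.
  - move=> i hi; have -> : (S r - i = S (S r - S i))%nat by lia.
    exists (act (gpow g (S r - S i)) z).
    by have [h1 h2] := gpow_strict g h z (S r - S i) hz nhz; split=> // h3; apply: h3.
  - by rewrite Nat.sub_0_r; apply.
  - by rewrite Nat.sub_diag tr1.
apply: (chain_bound (fun i => tr (gpow g (S r + i)) h) u).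
- by move=> i; case: (hh' (S r + i)%nat) => _ [_ []].
- by move=> i; case: (hh' (S r + i)%nat) => _ [_ []].
- by move=> i t; apply: gpow_decr => //; lia.
- move=> i hi; exists (act (gpow g (S r + i)) z); rewrite Nat.add_succ_r.
  exact: gpow_strict.
- by rewrite Nat.add_0_r.
- exact: clv.
Qed.

Definition gatep (C : X -> Prop) (z : X) : X := epsilon (inhabits z) (gate C z).

Definition dist (z : X) (A : X -> Prop) : R := d z (gatep (cl A) z).

Lemma gatepP A z : convex X d A -> (exists x, A x) -> gate (cl A) z (gatep (cl A) z).
Proof.
move=> cA [x Ax]; rewrite /gatep; apply: epsilon_spec; apply: gate_ex.
- exact: cl_convex.
- exact: cl_closed.
- by exists x; apply: cl_sub.
Qed.

Lemma dist_le A z a : convex X d A -> A a -> dist z A <= d z a.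
Proof.
move=> cA Aa; apply: (gate_dist_le (cl A)); last exact: cl_sub.
by apply: gatepP => //; exists a.
Qed.

Lemma dist_ge A z rho : convex X d A -> (exists x, A x) -> (forall a, A a -> rho <= d z a) ->
  rho <= dist z A.
Proof.
move=> cA neA h; apply: le_epsilon => e he; have [hcl _] := gatepP A z cA neA.
by have [y Ay hy] := hcl e he; have := h y Ay; have := dist_tri z (gatep (cl A) z) y; rewrite /dist; lra.
Qed.

Lemma dist_mono A B z : convex X d A -> convex X d B -> (exists x, B x) -> (forall x, B x -> A x) ->
  dist z A <= dist z B.
Proof. by move=> cA cB neB h; apply: dist_ge => // b /h hb; apply: dist_le. Qed.

Lemma dist_tr g A z : convex X d A -> (exists x, A x) -> dist (act g z) (tr g A) = dist z A.
Proof.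
move=> cA [a0 Aa0]; apply: Rle_antisym.
  apply: dist_ge => //; first by exists a0.
  move=> a Aa; rewrite -(act_dist g z a); apply: dist_le; first exact: tr_convex.
  exact: tr_act.
apply: dist_ge; first exact: tr_convex.
  by exists (act g a0); apply: tr_act.
by move=> a Aa; rewrite -(act_dist (ginv g)) actK; apply: dist_le.
Qed.

Lemma dist_lip A x y : convex X d A -> (exists x, A x) -> dist x A <= d x y + dist y A.
Proof.
move=> cA neA; suff : dist x A - d x y <= dist y A by lra.
apply: dist_ge => // a Aa; have := dist_le A x a cA Aa; have := dist_tri x y a; lra.
Qed.

(** The median of [y], [z] and a point [w] of [l] lies in [h] but not in [k]: on the way from [y] to
    [w] one reaches [h] first and still has to cross the gap [rho]. *)
Lemma dist_gap h k l z rho y : convex X d h -> convex X d (compl k) -> convex X d l ->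
  (exists x, l x) -> (forall x, k x -> h x) -> (forall x, l x -> h x) ->
  h z -> ~ k z -> far rho (compl k) l -> ~ h y -> dist y h + rho <= dist y l.
Proof.
move=> ch ck cl' nel kh lh hz nkz hfar nhy; apply: dist_ge => // w lw.
set u := med y w z.
have hu : h u by apply: med_convex2 => //; apply: lh.
have ku : compl k u by apply: (med_convex3 (compl k)) => // ky; apply/nhy/kh.
have := dist_le h y u ch hu; have := hfar u w ku lw.
have := med_int1 y w z; rewrite -/u; metric.
Qed.

(** * Busemann cocycles and ends *)

Section Busemann.
Variable F : (X -> Prop) -> Prop.
Hypothesis F_convex : forall A, F A -> convex X d A.
Hypothesis F_inh : forall A, F A -> exists x, A x.
Hypothesis F_ne : exists A, F A.
Hypothesis F_dir : forall A B, F A -> F B ->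
  exists C, F C /\ (forall x, C x -> A x) /\ (forall x, C x -> B x).

Lemma antitone_limit (u : (X -> Prop) -> R) b :
  (forall A B, F A -> F B -> (forall x, B x -> A x) -> u B <= u A) -> (forall A, F A -> b <= u A) ->
  exists L, forall e, 0 < e -> exists2 A, F A &
    forall B, F B -> (forall x, B x -> A x) -> L <= u B < L + e.
Proof.
move=> anti low; have [A0 FA0] := F_ne.
have [||m [hm happ]] := infimum (fun t => exists2 A, F A & t = u A - b).
- by exists (u A0 - b), A0.
- by move=> t [A /low h ->]; lra.
exists (m + b) => e he; have [t [[A FA ->] ht]] := happ e he.
exists A => // B FB hBA; have := anti A B FA FB hBA.
by have := hm (u B - b) (ex_intro2 _ _ B FB eq_refl); lra.
Qed.

(** The change in the difference of distances is paid for by the shrinking distance between the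
    gates. Hence this gate distance, and its sum with the difference, both decrease along [F]; being
    bounded below they converge, which yields the Busemann limit. *)
Lemma gate_pair_contraction A B x y : F A -> F B -> (forall z, B z -> A z) ->
  Rabs ((dist x B - dist y B) - (dist x A - dist y A)) <=
  d (gatep (cl A) x) (gatep (cl A) y) - d (gatep (cl B) x) (gatep (cl B) y).
Proof.
move=> FA FB BA.
have gx := gatepP A x (F_convex _ FA) (F_inh _ FA).
have gy := gatepP A y (F_convex _ FA) (F_inh _ FA).
have gx' := gatepP B x (F_convex _ FB) (F_inh _ FB).
have gy' := gatepP B y (F_convex _ FB) (F_inh _ FB).
rewrite /dist; move: gx gy gx' gy'.
move: (gatep (cl A) x) (gatep (cl A) y) (gatep (cl B) x) (gatep (cl B) y) => u v u' v' gx gy gx' gy'.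
have clBA t : cl B t -> cl A t by apply: cl_mono.
have h1 := proj2 gx _ (clBA _ (proj1 gx')).
have h2 := proj2 gy _ (clBA _ (proj1 gy')).
have h3 : I u v' u' by apply: (proj2 (gate_between (cl B) x u' u gx' h1)); case: gy'.
have h4 : I v u' v' by apply: (proj2 (gate_between (cl B) y v' v gy' h2)); case: gx'.
have t1 := dist_tri u v v'; have t2 := dist_tri v u u'.
apply: Rabs_le; split; metric.
Qed.

Definition busemann (x y : X) (L : R) : Prop :=
  forall e, 0 < e -> exists2 A, F A &
    forall B, F B -> (forall z, B z -> A z) -> Rabs (dist x B - dist y B - L) <= e.

Lemma busemann_ex x y : exists L, busemann x y L.
Proof.
pose e A := d (gatep (cl A) x) (gatep (cl A) y).
pose f A := dist x A - dist y A.
have key A B (FA : F A) (FB : F B) (BA : forall z, B z -> A z) :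
    Rabs (f B - f A) <= e A - e B by apply: gate_pair_contraction.
have [||Le hLe] := antitone_limit e 0.
- by move=> A B FA FB BA; have := key A B FA FB BA; have := Rabs_pos (f B - f A); lra.
- by move=> A _; apply: dist_ge0.
have [||Lu hLu] := antitone_limit (fun A => f A + e A) (- d x y).
- move=> A B FA FB BA; have := key A B FA FB BA.
  have := Rle_abs (f B - f A); lra.
- move=> A FA; have := dist_lip A y x (F_convex _ FA) (F_inh _ FA).
  have : 0 <= e A by apply: dist_ge0.
  by rewrite (dist_sym y x) /f; lra.
exists (Lu - Le) => eps heps.
have [A FA hA] := hLe eps heps; have [B FB hB] := hLu eps heps.
have [C [FC [CA CB]]] := F_dir A B FA FB.
exists C => // D FD DC.
have h1 := hA D FD (fun z hz => CA z (DC z hz)); have h2 := hB D FD (fun z hz => CB z (DC z hz)).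
rewrite -/(f D); apply: Rabs_le; split; lra.
Qed.

Lemma busemann_xx x : busemann x x 0.
Proof.
move=> e he; have [A FA] := F_ne; exists A => // B _ _.
by rewrite Rminus_diag Rminus_0_r Rabs_R0; lra.
Qed.

Lemma busemann_opp x y L : busemann x y L -> busemann y x (- L).
Proof.
move=> h e he; have [A FA hA] := h e he; exists A => // B FB BA.
have := hA B FB BA; rewrite -(Rabs_Ropp (_ - _ - - L)).
by have -> : - (dist y B - dist x B - - L) = dist x B - dist y B - L by ring.
Qed.

Lemma busemann_add x y z L M : busemann x y L -> busemann y z M -> busemann x z (L + M).
Proof.
move=> h k e he.
have [|A FA hA] := h (e / 2); first lra.
have [|B FB hB] := k (e / 2); first lra.
have [C [FC [CA CB]]] := F_dir A B FA FB.
exists C => // D FD DC.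
have h1 := hA D FD (fun t ht => CA t (DC t ht)); have h2 := hB D FD (fun t ht => CB t (DC t ht)).
have -> : dist x D - dist z D - (L + M) = (dist x D - dist y D - L) + (dist y D - dist z D - M) by ring.
by apply: Rle_trans (Rabs_triang _ _) _; lra.
Qed.

Lemma busemann_tr g x y L : (forall A, F A -> F (tr g A)) -> (forall A, F A -> F (tr (ginv g) A)) ->
  busemann x y L -> busemann (act g x) (act g y) L.
Proof.
move=> hF hF' h e he; have [A FA hA] := h e he.
exists (tr g A); first exact: hF.
move=> B FB BA; have FB' := hF' _ FB.
rewrite -{1 2}(trVK g B) !dist_tr; try exact: F_convex; try exact: F_inh.
by apply: hA => // z; rewrite /tr ginvK => /BA /tr_act_inv.
Qed.

Variable H : G -> Prop.
Hypothesis H_sub : subgroup G H.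
Hypothesis H_F : forall g A, H g -> F A -> F (tr g A).

Lemma busemann_act g x y L : H g -> busemann x y L -> busemann (act g x) (act g y) L.
Proof.
move=> Hg; have [_ [_ hV]] := H_sub.
by apply: busemann_tr => A; apply: H_F => //; apply: hV.
Qed.

Lemma busemann_mul x g k L M : H g -> busemann x (act g x) L -> busemann x (act k x) M ->
  busemann x (act (g ** k) x) (L + M).
Proof. by move=> Hg hL hM; rewrite actM; apply: (busemann_add _ (act g x)) => //; apply: busemann_act. Qed.

Lemma busemann_inv x g L : H g -> busemann x (act g x) L -> busemann x (act (ginv g) x) (- L).
Proof.
move=> Hg hL; apply: busemann_opp; rewrite -{2}(actK g x); apply: busemann_act => //.
by apply H_sub.
Qed.

Lemma busemann_commutator x g : commutator_subgroup G H g -> H g /\ busemann x (act g x) 0.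
Proof.
have [h1 [hM hV]] := H_sub.
move=> /(_ (fun g => H g /\ busemann x (act g x) 0)); apply.
- split; first by split=> //; rewrite act1; apply: busemann_xx.
  split=> [a b [Ha ba] [Hb bb]|a [Ha ba]].
    by split; [apply: hM|rewrite -(Rplus_0_l 0); apply: busemann_mul].
  by split; [apply: hV|rewrite -Ropp_0; apply: busemann_inv].
move=> a b Ha Hb; split; first exact: hM (hM _ _ (hV _ Ha) (hV _ Hb)) (hM _ _ Ha Hb).
have [L hL] := busemann_ex x (act a x); have [M hM'] := busemann_ex x (act b x).
have -> : 0 = (- L + - M) + (L + M) by ring.
apply: busemann_mul; [by apply: hM; apply: hV| |].
  by apply: busemann_mul; [apply: hV|apply: busemann_inv|apply: busemann_inv].
by apply: busemann_mul.
Qed.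

End Busemann.

Lemma rank_list l : (forall h, In h l -> halfspace X d h) -> ForallOrdPairs (transverse X) l ->
  (length l <= r)%nat.
Proof.
move=> hl hp; case: (le_lt_dec (length l) r) => // hlen; exfalso.
apply: (Hr (fun i => nth i l (fun _ => False))) => [i hi|i j hij].
  by apply: hl; apply: nth_In; lia.
by apply: ForallOrdPairs_nth hp _; lia.
Qed.

(** The step [m] leaves room for a layer between two consecutive translates, where [dist_gap] needs
    a point, followed by a gap from [skewer_thick]. *)
Lemma skewer_growth g h : halfspace X d h -> skewers g h ->
  exists m rho, 0 < rho /\
    forall x n, ~ h x -> dist x (tr (gpow g n) h) + rho <= dist x (tr (gpow g (n + m)) h).
Proof.
move=> hh hs; have [n0 [rho [hrho hfar]]] := skewer_thick g h hh hs.
have [hdec [z [hz nhz]]] := hs.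
have hh' i := tr_halfspace (gpow g i) _ hh.
exists (S n0 + n0)%nat, rho; split=> // x n nhx.
have cnv i : convex X d (tr (gpow g i) h) by case: (hh' i) => _ [_ []].
have ccnv i : convex X d (compl (tr (gpow g i) h)) by case: (hh' i) => _ [_ []].
have [z1 z2] := gpow_strict g h z n hz nhz.
apply: (dist_gap _ (tr (gpow g (S n + 0)) h) _ (act (gpow g n) z)) => //.
- by case: (hh' (n + (S n0 + n0))%nat).
- by move=> y; apply: gpow_decr => //; lia.
- by move=> y; apply: gpow_decr => //; lia.
- by rewrite Nat.add_0_r.
- have -> : (n + (S n0 + n0) = (S n + n0) + n0)%nat by lia.
  rewrite Nat.add_0_r gpowD trM.
  move=> a b ha hb; apply: (tr_far (gpow g (S n + n0)) _ _ _ hfar) => // hb'.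
  by apply: ha; apply: gpow_decr hb' => //; lia.
by move=> hx; apply: nhx; rewrite -(tr1 h); apply: (gpow_decr g h hdec 0 n) => //; lia.
Qed.

Lemma skewer_deep g h x b : halfspace X d h -> skewers g h ->
  exists n0, forall n, (n0 <= n)%nat -> b < dist x (tr (gpow g n) h).
Proof.
move=> hh hs; have [m [rho [hrho hgrow]]] := skewer_growth g h hh hs.
have [hdec _] := hs.
have [_ [[y nhy] [ch _]]] := hh.
have hh' i := tr_halfspace (gpow g i) _ hh.
have lin k : INR k * rho <= dist y (tr (gpow g (k * m)) h).
  elim: k => [|k IH]; first by rewrite Rmult_0_l; apply: dist_ge0.
  have e : (S k * m = k * m + m)%nat by lia.
  have := hgrow y (k * m)%nat nhy; rewrite S_INR e; lra.
have [k hk] := INR_unbounded ((b + d x y) / rho).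
have hk' : b + d x y < INR k * rho.
  have e : b + d x y = (b + d x y) / rho * rho by field; lra.
  by rewrite e; apply: Rmult_lt_compat_r.
exists (k * m)%nat => n hn.
have h1 : dist y (tr (gpow g (k * m)) h) <= dist y (tr (gpow g n) h).
  apply: dist_mono; try (by case: (hh' n) => _ [_ []]); try (by case: (hh' (k * m)%nat) => _ [_ []]).
    by case: (hh' n).
  by move=> t; apply: gpow_decr.
have [ne _] := hh' n; have cn : convex X d (tr (gpow g n) h) by case: (hh' n) => _ [_ []].
have := dist_lip _ y x cn ne; have := lin k; rewrite (dist_sym y x); lra.
Qed.

Section Boundary.
Variable sigma : (X -> Prop) -> Prop.
Hypothesis sigma_half : forall h, sigma h -> halfspace X d h.
Hypothesis sigma_meet : forall h k, sigma h -> sigma k -> exists x, h x /\ k x.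
Hypothesis sigma_total : forall h, halfspace X d h -> sigma h \/ sigma (compl h).
Variable H : G -> Prop.
Hypothesis H_index : finite_index G H.
Hypothesis H_sigma : forall g h, H g -> sigma h -> sigma (tr g h).

Lemma H_subgroup : subgroup G H.
Proof. by case: H_index. Qed.

Lemma sigma_convex h : sigma h -> convex X d h.
Proof. by move=> /sigma_half [_ [_ []]]. Qed.

Lemma sigma_gpow g h n : H g -> sigma h -> sigma (tr (gpow g n) h).
Proof. by move=> Hg sh; apply: H_sigma => //; apply: gpow_sub => //; apply: H_subgroup. Qed.

(* The end of the chain of translates of [h] by powers of [g], as a filter in [sigma]. *)
Definition end_family (h : X -> Prop) (g : G) (k : X -> Prop) : Prop :=
  sigma k /\ exists n, forall x, tr (gpow g n) h x -> k x.

Definition is_end (F : (X -> Prop) -> Prop) : Prop :=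
  exists h g, sigma h /\ H g /\ skewers g h /\ F = end_family h g.

Lemma end_family_gpow h g n : H g -> sigma h -> end_family h g (tr (gpow g n) h).
Proof. by move=> Hg sh; split; [apply: sigma_gpow|exists n]. Qed.

(* Representatives of distinct ends are chosen one end at a time, a minimal end last and very deep:
   depth excludes one inclusion between representatives, and the list [A] of ends to be avoided
   excludes the other. *)
Lemma ends_transverse x : forall n l A, length l = n -> NoDup l ->
  (forall F, In F l -> is_end F) -> (forall F, In F A -> is_end F) ->
  exists ks, length ks = n /\ ForallOrdPairs (transverse X) ks /\
    forall k, In k ks -> sigma k /\ ~ k x /\ exists F, In F l /\ F k /\
      forall F' : (X -> Prop) -> Prop, In F' A -> ~ (forall t, F t -> F' t) -> ~ F' k.
Proof.
elim=> [|n IH] l A hlen hnd hl hA.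
  by exists nil; split=> //; split=> //; constructor.
have [||||m [hm hmin]] := list_minimal (fun F F' : (X -> Prop) -> Prop => forall t, F t -> F' t) l.
- by [].
- by move=> a b c hab hbc t /hab /hbc.
- by move=> a b hab hba; apply: pred_ext => t; split; auto.
- by move=> e; rewrite e in hlen.
have [l1 [l2 e]] := in_split _ _ hm.
have hsub F : In F (l1 ++ l2) -> In F l.
  by rewrite e => hF; apply: in_or_app; case: (in_app_or _ _ _ hF); [left|right; right].
have hnd' : NoDup (l1 ++ m :: l2) by rewrite -e.
have nm := NoDup_remove_2 _ _ _ hnd'.
have [|||ks [hks [htr hk]]] := IH (l1 ++ l2) (m :: A) _ (NoDup_remove_1 _ _ _ hnd').
- by move: hlen; rewrite e !length_app /=; lia.
- by move=> F /hsub /hl.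
- by move=> F [<-|/hA //]; apply: hl.
have [h [g [sh [Hg [hs em]]]]] := hl m hm.
have hh := sigma_half _ sh; have [hdec _] := hs.
have [||b hb] := list_bound (fun k b => dist x k <= b) ks.
- by move=> k b c; lra.
- by move=> k _; exists (dist x k); lra.
have [n0 hn0] := skewer_deep g h x (Rmax b 0) hh hs.
(* Some [t] belongs to [m] but not to [F']. Deep translates of [h] lie inside [t], and [F'] is
   closed upwards in [sigma], so it cannot contain them. *)
have [N hN] : exists N, forall F', In F' A -> ~ (forall t, m t -> F' t) ->
    forall n, (N <= n)%nat -> ~ F' (tr (gpow g n) h).
  elim: (A) hA => [|F' A' IHA] hA; first by exists 0%nat.
  have [|N hN] := IHA; first by move=> F hF; apply: hA; right.
  case: (classic (exists t, m t /\ ~ F' t)) => [[t [mt nt]]|hn].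
    have [st [n1 hn1]] : end_family h g t by rewrite -em.
    exists (max N n1) => F'' [<- _ k hk' hF|hF'' hm' k hk']; last by apply: hN => //; lia.
    apply: nt; move: (hA F' (or_introl eq_refl)) hF => [h2 [g2 [_ [_ [_ ->]]]]] [_ [n2 hn2]].
    by split=> //; exists n2 => y /hn2 hy; apply: hn1; apply: (gpow_decr g h) hy => //; lia.
  exists N => F'' [<- hm' k hk'|hF'' hm' k hk']; last exact: hN.
  by case: hm' => t mt; apply: NNPP => nt; apply: hn; exists t.
set k0 := tr (gpow g (max N n0)) h.
have sk0 : sigma k0 by apply: sigma_gpow.
have mk0 : m k0 by rewrite em; apply: end_family_gpow.
have dk0 : Rmax b 0 < dist x k0 by apply: hn0; lia.
have nk0 : ~ k0 x.
  move=> kx; have := dist_le k0 x x (sigma_convex _ sk0) kx; rewrite dist_xx.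
  by have := Rmax_r b 0; lra.
exists (k0 :: ks); split; first by rewrite /= hks.
split.
  (* Quadrants: both sets are in [sigma]; [k0] is not inside [k], as [k] avoids [m]; [k] is not
     inside [k0], which is further from [x]; and [x] is outside both. *)
  constructor=> //; apply/Forall_forall => k hkk.
  have [sk [nk [F [Fl [Fk hF]]]]] := hk k hkk.
  have nmk : ~ m k.
    apply: hF; first by left.
    by move=> hFm; apply: nm; rewrite -(hmin F) //; apply: hsub.
  split; first exact: sigma_meet.
  split.
    apply: NNPP => hn; apply: nmk; rewrite em; split=> //; exists (max N n0) => y hy.
    by apply: NNPP => ky; apply: hn; exists y.
  split; last by exists x.
  apply: NNPP => hn; have : dist x k0 <= dist x k.
    apply: dist_mono; [exact: sigma_convex|exact: sigma_convex|by case: (sigma_half _ sk)|].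
    by move=> y ky; apply: NNPP => ny; apply: hn; exists y.
  by have := hb k hkk; have := Rmax_l b 0; lra.
move=> k [<-|hkk].
  split=> //; split=> //; exists m; split=> //; split=> // F' hF' hm'.
  by apply: hN => //; lia.
have [sk [nk [F [Fl [Fk hF]]]]] := hk k hkk.
split=> //; split=> //; exists F; split; first exact: hsub.
by split=> // F' hF'; apply: hF; right.
Qed.

Lemma ends_finite (x : X) : finite_set is_end.
Proof.
have [l hl hp|l [_ [_ hl]]] := maximal_unrelated is_end eq r.
  have hnd : NoDup l.
    elim: hp {hl} => [|a l' ha _ IH]; constructor=> // hin.
    by move/Forall_forall: ha => /(_ a hin).
  have [ks [<- [htr hk]]] := ends_transverse x _ l nil eq_refl hnd hl (fun F => False_ind _).
  by apply: rank_list htr => k /hk [/sigma_half].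
by exists l => F /hl [F' hF' ->].
Qed.

Lemma H_inv g : H g -> H (ginv g).
Proof. by apply H_subgroup. Qed.

Lemma is_end_tr g F : H g -> is_end F -> is_end (trF g F).
Proof.
move=> Hg [h [s [sh [Hs [[hdec [z [hz nhz]]] ->]]]]].
have cj n : tr (gpow (g ** s ** ginv g) n) (tr g h) = tr g (tr (gpow s n) h).
  by rewrite gpow_conj -!trM gmulVK.
exists (tr g h), (g ** s ** ginv g); split; first exact: H_sigma.
split.
  by have [_ [hM _]] := H_subgroup; apply: (hM); [apply: (hM)|apply: H_inv].
have cj1 : tr (g ** s ** ginv g) (tr g h) = tr g (tr s h) by rewrite -!trM gmulVK.
split.
  split; first by rewrite cj1; apply: tr_mono.
  exists (act g z); rewrite cj1; split; first exact: tr_act.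
  by move=> /tr_act_inv.
apply: pred_ext => k; rewrite /trF /end_family; split=> -[sk [n hn]].
  split; first by rewrite -(trVK g k); apply: H_sigma.
  by exists n; rewrite cj -(trVK g k); apply: tr_mono.
split; first by apply: H_sigma => //; apply: H_inv.
by exists n; rewrite -(trK g (tr (gpow s n) h)) -cj; apply: tr_mono.
Qed.

Definition end_stabiliser (g : G) : Prop := H g /\ forall F, is_end F -> trF g F = F.

Lemma end_stabiliser_index (x : X) : finite_index G end_stabiliser.
Proof.
apply: (finite_index_stabiliser G trF H is_end) => //; try exact: ends_finite.
- exact: trF1.
- exact: trFM.
- by move=> g F; apply: is_end_tr.
Qed.

(* The Busemann cocycle of the end of [g] vanishes on products of commutators, whereas along
   the chain [gpow g n] the distance to the halfspaces grows linearly. *)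
Lemma commutator_no_skewer g h : commutator_subgroup G end_stabiliser g -> sigma h -> ~ skewers g h.
Proof.
move=> hg sh hs.
have hh := sigma_half _ sh; have [hdec _] := hs.
have [_ [[x nhx] _]] := hh.
have [sS _] := end_stabiliser_index x.
have [Hg _] := commutator_sub _ _ sS g hg.
have hend : is_end (end_family h g) by exists h, g.
have [m [rho [hrho hgrow]]] := skewer_growth g h hh hs.
have cF A : end_family h g A -> convex X d A by move=> [/sigma_convex].
have iF A : end_family h g A -> exists y, A y by move=> [/sigma_half []].
have neF : exists A, end_family h g A by exists (tr (gpow g 0) h); apply: end_family_gpow.
have dF A B : end_family h g A -> end_family h g B ->
    exists C, end_family h g C /\ (forall y, C y -> A y) /\ (forall y, C y -> B y).
  move=> [_ [n1 h1]] [_ [n2 h2]]; exists (tr (gpow g (max n1 n2)) h).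
  split; first exact: end_family_gpow.
  by split=> y hy; [apply: h1|apply: h2]; apply: (gpow_decr g h) hy => //; lia.
have sF k A : end_stabiliser k -> end_family h g A -> end_family h g (tr k A).
  by move=> [_ hk] hA; rewrite -(hk _ hend) /trF trK.
have gm : commutator_subgroup G end_stabiliser (gpow g m).
  by move=> K hK hab; apply: gpow_sub => //; apply: hg.
have [_ hB] := busemann_commutator _ cF iF neF dF _ sS sF x _ gm.
have [|A [_ [n1 h1]] hA] := hB (rho / 2); first lra.
have {hA} := hA (tr (gpow g (n1 + m)) h) (end_family_gpow _ _ _ Hg sh).
have -> : dist (act (gpow g m) x) (tr (gpow g (n1 + m)) h) = dist x (tr (gpow g n1) h).
  rewrite Nat.add_comm gpowD trM dist_tr //; first by apply: sigma_convex; apply: sigma_gpow.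
  by case: (sigma_half _ (sigma_gpow g h n1 Hg sh)).
have hsub y : tr (gpow g (n1 + m)) h y -> A y.
  by move=> hy; apply: h1; apply: (gpow_decr g h) hy => //; lia.
move=> /(_ hsub); have := hgrow x n1 nhx.
have := Rle_abs (dist x (tr (gpow g (n1 + m)) h) - dist x (tr (gpow g n1) h) - 0); lra.
Qed.

(** For three sets, take the median of points in the pairwise intersections; [A] accumulates the
    sets already intersected. *)
Lemma helly l : forall A, convex X d A -> (exists x, A x) ->
  (forall B, In B l -> convex X d B) -> (forall B, In B l -> exists x, A x /\ B x) ->
  (forall B C, In B l -> In C l -> exists x, B x /\ C x) ->
  exists x, A x /\ forall B, In B l -> B x.
Proof.
elim: l => [|B l IH] A cA [x Ax] cl' hA hl; first by exists x.
have cB := cl' B (or_introl eq_refl).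
have [|||||y [[Ay By] hy]] := IH (fun x => A x /\ B x).
- exact: convex_and.
- by apply: hA; left.
- by move=> C hC; apply: cl'; right.
- move=> C hC; have cC := cl' C (or_intror hC).
  have [u [Au Bu]] := hA B (or_introl eq_refl).
  have [v [Av Cv]] := hA C (or_intror hC).
  have [w [Bw Cw]] := hl B C (or_introl eq_refl) (or_intror hC).
  exists (med u v w); split; last exact: med_convex2.
  by split; [apply: med_convex|apply: med_convex3].
- by move=> C D hC hD; apply: hl; right.
by exists y; split=> // C [<-|/hy].
Qed.

(** * Fixed points of groups without skewering elements *)

(* [u] lies between [x] and the point at infinity [sigma].  The closures make the relation
   insensitive to the choices of [sigma] among halfspaces with the same boundary. *)
Definition below (u x : X) : Prop := forall h, sigma h -> cl h x -> cl h u.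

Lemma below_refl x : below x x.
Proof. by []. Qed.

Lemma below_trans u v w : below u v -> below v w -> below u w.
Proof. by move=> h1 h2 h sh /(h2 h sh) /(h1 h sh). Qed.

(** Descending towards [sigma] is geodesic. A halfspace separating [v] from the median [m] even up
    to closure contradicts one of the two relations, whichever of its sides is in [sigma]. *)
Lemma below_between u v x : below u v -> below v x -> I x u v.
Proof.
move=> huv hvx; apply: NNPP => hn; set m := med x u v.
have hm : v <> m by move=> e; apply: hn; rewrite e; apply: med_int1.
have [h [hh [h1 h2]]] := point_separation v m hm.
have [_ [_ [ch ch']]] := hh.
have nv : ~ h v by move=> hv; apply: h1; apply: cl_sub.
have hmh : h m by apply: NNPP => h3; apply: h2; apply: cl_sub.
case: (sigma_total h hh) => sh.
  have nx : ~ h x by move=> hx; apply: h1; apply: hvx => //; apply: cl_sub.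
  by apply: (med_convex3 (compl h) x u v).
apply: h2; apply: (med_convex2 (cl (compl h))); first exact: cl_convex.
  by apply: huv => //; apply: cl_sub.
exact: cl_sub.
Qed.

Lemma below_act g u x : H g -> below u x -> below (act g u) (act g x).
Proof.
move=> Hg hux h sh hx.
have e y : cl h (act g y) <-> cl (tr (ginv g) h) y by rewrite tr_cl /tr ginvK.
by apply/e; apply: hux; [apply: H_sigma => //; apply: H_inv|apply/e].
Qed.

(* The gates of [x] in the finite intersections of closed halfspaces of [sigma] meeting [I x y] move
   monotonically away from [x], hence converge. *)
Lemma meet_ex x y : exists u, I x y u /\ below u x /\ below u y.
Proof.
pose ok l := forall h, In h l -> sigma h /\ (cl h x \/ cl h y).
pose C l z := I x y z /\ forall h, In h l -> cl h z.
have ok_app l l' : ok l -> ok l' -> ok (l ++ l').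
  by move=> h1 h2 h /(in_app_or _ _ _) [/h1|/h2].
have cC l : ok l -> convex X d (C l).
  move=> hl a b z [Ia ha] [Ib hb] hz; split; first exact: int_convex hz.
  move=> h hin; have [sh _] := hl h hin.
  by apply: (cl_convex h (sigma_convex _ sh) a b); auto.
have clC l : closed (C l).
  move=> z hz; split; first by apply: closed_int; apply: cl_mono hz => t [].
  by move=> h hin; apply: cl_closed; apply: cl_mono hz => t [_]; apply.
have neC l : ok l -> exists z, C l z.
  move=> hl; have [|||||z [h1 h2]] := helly (map cl l) (I x y).
  - exact: int_convex.
  - by exists x; apply: int_left.
  - by move=> B /in_map_iff [h [<- /hl [sh _]]]; apply: cl_convex; apply: sigma_convex.
  - move=> B /in_map_iff [h [<- /hl [_ [hx|hy]]]].
      by exists x; split=> //; apply: int_left.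
    by exists y; split=> //; apply: int_right.
  - move=> B B' /in_map_iff [h [<- /hl [sh _]]] /in_map_iff [h' [<- /hl [sh' _]]].
    by have [t [ht ht']] := sigma_meet _ _ sh sh'; exists t; split; apply: cl_sub.
  by exists z; split=> // h hin; apply: h2; apply: in_map.
have hg l : ok l -> gate (C l) x (gatep (C l) x).
  by move=> hl; apply: epsilon_spec; apply: gate_ex; auto.
set c := fun l => gatep (C l) x in hg.
have [||m [hm happ]] := infimum (fun t => exists2 l, ok l & t = d x y - d x (c l)).
- by exists (d x y - d x (c nil)), nil.
- move=> t [l hl ->]; have [[h1 _] _] := hg l hl.
  by move: h1; rewrite /interval -/(c l); have := dist_ge0 (c l) y; lra.
pose e l := d x y - d x (c l) - m.
have e0 l : ok l -> 0 <= e l by move=> hl; have := hm _ (ex_intro2 _ _ l hl eq_refl); rewrite /e; lra.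
have step l l' : ok l -> ok l' -> (forall h, In h l -> In h l') -> d (c l) (c l') <= e l.
  move=> hl hl' sub; have [_ g1] := hg l hl; have [[i1 i2] _] := hg l' hl'.
  have : I x (c l') (c l) by apply: g1; split=> // h /sub; apply: i2.
  by have := e0 l' hl'; rewrite /e; metric.
have [||u hu] := net_limit (fun z t => exists l, ok l /\ z = c l /\ t = e l).
- move=> eps heps; have [t [[l hl ->] ht]] := happ eps heps.
  by exists (c l), (e l); split; [exists l|rewrite /e; lra].
- move=> z w t s [l [hl [-> ->]]] [l' [hl' [-> ->]]].
  have hll := ok_app _ _ hl hl'.
  have := step l (l ++ l') hl hll (fun h hin => in_or_app _ _ _ (or_introl hin)).
  have := step l' (l ++ l') hl' hll (fun h hin => in_or_app _ _ _ (or_intror hin)).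
  have := dist_tri (c l) (c (l ++ l')) (c l'); have := dist_sym (c l') (c (l ++ l')); lra.
have Cu l : ok l -> C l u.
  move=> hl; apply: clC => eps heps.
  have [|t [[l' hl' ->] ht]] := happ (eps / 2); first lra.
  have hll := ok_app _ _ hl' hl.
  exists (c (l' ++ l)).
    have [[h1 h2] _] := hg _ hll; split=> // h hin; apply: h2; apply: in_or_app; by right.
  have := step l' (l' ++ l) hl' hll (fun h hin => in_or_app _ _ _ (or_introl hin)).
  have := hu (c l') (e l') (ex_intro _ l' (conj hl' (conj eq_refl eq_refl))).
  have := dist_tri u (c l') (c (l' ++ l)); have := dist_sym u (c l'); rewrite /e; lra.
exists u; split; first by apply: (proj1 (Cu nil _)).
have one h : sigma h -> cl h x \/ cl h y -> cl h u.
  move=> sh hxy; apply: (proj2 (Cu (h :: nil) _)); last by left.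
  by move=> k [<-|[]].
by split=> h sh hxy; apply: one => //; [left|right].
Qed.

Lemma meet_list x l : exists u, below u x /\ (forall y, In y l -> below u y) /\
  forall C, convex X d C -> C x -> (forall y, In y l -> C y) -> C u.
Proof.
elim: l => [|y l [u [h1 [h2 h3]]]].
  by exists x; split; [apply: below_refl|split].
have [v [Iv [v1 v2]]] := meet_ex u y; exists v.
split; first exact: below_trans h1.
split; first by move=> z [<- //|/h2]; apply: below_trans.
move=> C cC Cx hC; apply: (cC u y) => //; last by apply: hC; left.
by apply: h3 => // z hz; apply: hC; right.
Qed.

Section FixedPoint.
Variables (gens : list G) (x : X).
Hypothesis gens_H : forall s, In s gens -> H s.
Hypothesis gens_inv : forall s, In s gens -> In (ginv s) gens.
Local Notation K := (generated G gens).
Hypothesis K_no_skewer : forall g h, K g -> sigma h -> ~ skewers g h.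

Lemma generated_subgroup : subgroup G K.
Proof.
split; first by move=> L [].
split=> [a b ha hb L hL hS|a ha L hL hS]; have [_ [hM hV]] := hL.
  by apply: (hM); [apply: ha|apply: hb].
by apply: hV; apply: ha.
Qed.

Lemma generated_in s : In s gens -> K s.
Proof. by move=> hs L _; apply. Qed.

Lemma generated_H g : K g -> H g.
Proof. by move=> hg; apply: hg => //; apply: H_subgroup. Qed.

(** Without a crossing edge in the Cayley graph, membership of the orbit points in [h] would be
    invariant under right multiplication by [K]. Symmetry of [gens] gives both directions. *)
Lemma orbit_crossing h : (exists2 g, K g & h (act g x)) -> ~ h x ->
  exists g s, K g /\ In s gens /\ ~ h (act g x) /\ h (act (g ** s) x).
Proof.
move=> [g0 Kg0 hg0] nhx; apply: NNPP => hn.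
have stay g s : K g -> In s gens -> ~ h (act g x) -> ~ h (act (g ** s) x).
  by move=> Kg hs h1 h2; apply: hn; exists g, s.
have [k1 [kM kV]] := generated_subgroup.
have [_ hM] : K g0 /\ forall g, K g -> (h (act g x) <-> h (act (g ** g0) x)).
  apply: (Kg0 (fun k => K k /\ forall g, K g -> (h (act g x) <-> h (act (g ** k) x)))).
    split; first by split=> // g _; rewrite gmul1r.
    split=> [a b [Ka ha] [Kb hb]|a [Ka ha]].
      by split=> [|g Kg]; [apply: kM|rewrite (ha g Kg) gmulA; apply: hb; apply: kM].
    split=> [|g Kg]; first exact: kV.
    by rewrite (ha (g ** ginv a)) ?gmulVK //; apply: kM => //; apply: kV.
  move=> s hs; have Ks := generated_in s hs; split=> // g Kg; split=> hg; apply: NNPP => hg'.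
    apply: (stay (g ** s) (ginv s)) => //; [exact: kM|exact: gens_inv|by rewrite gmulK].
  exact: (stay g s).
by apply: nhx; have := proj2 (hM gone k1); rewrite act1 gmul1; apply.
Qed.

Lemma descending_orbit : exists p : nat -> X, p 0%nat = x /\
  (forall n, below (p (S n)) (p n)) /\
  (forall n s, In s gens -> below (p (S n)) (act s (p n))) /\
  (forall n C, convex X d C -> (forall g, K g -> C (act g x)) -> C (p n)).
Proof.
pose E (u v : X) := below v u /\ (forall s, In s gens -> below v (act s u)) /\
  forall C, convex X d C -> C u -> (forall s, In s gens -> C (act s u)) -> C v.
have [//|u _|p [p0 hp]] := dependent_choice (fun _ => True) E x.
  have [v [h1 [h2 h3]]] := meet_list u (map (fun s => act s u) gens).
  exists v; split=> //; split=> //; split; first by move=> s hs; apply: h2; apply: in_map.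
  move=> C cC Cu hC; apply: h3 => // y /in_map_iff [s [<- hs]]; exact: hC.
exists p; split=> //; split; first by move=> n; case: (hp n) => _ [].
split; first by move=> n; case: (hp n) => _ [_ []].
have [k1 [kM kV]] := generated_subgroup.
elim=> [|n IH] C cC hC; first by rewrite p0 -(act1 x); apply: hC.
have [_ [_ [_ h]]] := hp n; apply: h => //; first exact: IH.
move=> s hs; have := IH (tr (ginv s) C) (tr_convex _ _ cC).
rewrite /tr ginvK; apply=> g Kg; rewrite -actM; apply: hC.
by apply: (kM) => //; apply: generated_in.
Qed.

Section Descent.
Variable p : nat -> X.
Hypothesis p_zero : p 0%nat = x.
Hypothesis p_desc : forall n, below (p (S n)) (p n).
Hypothesis p_gens : forall n s, In s gens -> below (p (S n)) (act s (p n)).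
Hypothesis p_hull : forall n C, convex X d C -> (forall g, K g -> C (act g x)) -> C (p n).

Lemma p_mono m n : (m <= n)%nat -> below (p n) (p m).
Proof. by elim=> [|k _ IH]; [apply: below_refl|apply: below_trans IH]. Qed.

Lemma p_dist m n : (m <= n)%nat -> d x (p n) = d x (p m) + d (p m) (p n).
Proof.
move=> hmn; have : I x (p n) (p m); last by rewrite /interval.
by apply: below_between; [apply: p_mono|rewrite -p_zero; apply: p_mono; lia].
Qed.

(** The descent is geodesic, hence Cauchy when bounded. Since [p (S n)] lies between [act s (p n)]
    and [act s (p (S (S n)))], it is close to [act s (p n)], so the limit is fixed. *)
Lemma bounded_fixed b : (forall n, d x (p n) <= b) -> exists y, forall s, In s gens -> act s y = y.
Proof.
move=> hb.
have [||m [hm happ]] := infimum (fun t => exists n, t = b - d x (p n)).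
- by exists (b - d x (p 0%nat)), 0%nat.
- by move=> t [n ->]; have := hb n; lra.
pose e n := b - d x (p n) - m.
have e0 n : 0 <= e n by have := hm _ (ex_intro _ n eq_refl); rewrite /e; lra.
have hpp m' n : (m' <= n)%nat -> d (p m') (p n) <= e m'.
  by move=> h; have := p_dist _ _ h; have := e0 n; rewrite /e; lra.
have [||y hy] := net_limit (fun z t => exists n, z = p n /\ t = e n).
- move=> eps heps; have [t [[n ->] ht]] := happ eps heps.
  by exists (p n), (e n); split; [exists n|rewrite /e; lra].
- move=> z w t s [n [-> ->]] [k [-> ->]].
  case: (Nat.le_ge_cases n k) => h; first by have := hpp _ _ h; have := e0 k; lra.
  by have := hpp _ _ h; have := e0 n; rewrite (dist_sym (p k)); lra.
have hy' n : d (p n) y <= e n by apply: hy; exists n.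
exists y => s hs; apply: dist_eq0; apply: le_epsilon => eps heps.
have [|t [[n ->] ht]] := happ (eps / 3); first lra.
have hen : e n < eps / 3 by rewrite /e; lra.
have hb1 : below (act s (p (S (S n)))) (p (S n)).
  rewrite -(actVK s (p (S n))); apply: below_act; first exact: gens_H.
  by apply: p_gens; apply: gens_inv.
have hb2 := below_between _ _ _ hb1 (p_gens n s hs).
have := hpp n (S (S n)) ltac:(lia); have := hy' n; have := hy' (S n).
have e1 : e (S n) <= e n.
  by have := p_dist n (S n) ltac:(lia); have := dist_ge0 (p n) (p (S n)); rewrite /e; lra.
have := dist_tri (act s y) (act s (p n)) y; have := dist_tri (act s (p n)) (p (S n)) y.
have := act_dist s y (p n); have := dist_sym y (p n).
have := act_dist s (p n) (p (S (S n))).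
have := dist_ge0 (p (S n)) (act s (p (S (S n)))).
by move: hb2; rewrite /interval; lra.
Qed.

Definition unbounded_from (C : X -> Prop) : Prop :=
  forall b, exists n, forall c, C c -> b < d c (p n).

(* If every thick halfspace facing [C] were passed by the sequence only boundedly far, further and
   further separations would give [S r] pairwise transverse halfspaces. *)
Lemma thick_step C rho0 : convex X d C -> closed C -> C x -> unbounded_from C ->
  exists h, sigma h /\ far rho0 C h /\ unbounded_from (cl (compl h)).
Proof.
move=> cC clC Cx hC; apply: NNPP => hn.
have sep rho : 0 < rho -> exists n h, sigma h /\ far rho C h /\ forall y, d (p n) y <= rho -> h y.
  move=> hrho; have [n hgt] := hC (2 * INR r * rho).
  have [h [hh [hfar hball]]] := thick_separation C rho (p n) cC clC (ex_intro _ x Cx) hrho hgt.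
  exists n, h; split=> //; case: (sigma_total h hh) => // sh.
  have nx : compl h x by move=> hx; have := hfar x x Cx hx; rewrite dist_xx; lra.
  have hpx : below (p n) x by rewrite -p_zero; apply: p_mono; lia.
  have [y nhy hy] := hpx _ sh (cl_sub _ _ nx) rho hrho.
  by case: nhy; apply: hball; lra.
pose Q k b := exists n, k (p n) /\ d x (p n) <= b /\ forall m, exists2 c, cl (compl k) c & d c (p m) <= b.
have build m : exists ks, length ks = m /\ ForallOrdPairs (transverse X) ks /\
    forall k, In k ks -> sigma k /\ ~ k x /\ exists b, Q k b.
  elim: m => [|m [ks [hlen [htr hks]]]].
    by exists nil; split=> //; split=> //; constructor.
  have [|k /hks [_ [_ //]]|b hb] := list_bound Q ks.
    move=> k b c [n [h1 [h2 h3]]] hbc; exists n; split=> //; split; first lra.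
    by move=> j; have [y hy hd] := h3 j; exists y => //; lra.
  set rho := Rmax (Rmax rho0 1) (b + 1).
  have hr1 : rho0 <= rho by apply: Rle_trans (Rmax_l _ _); apply: Rmax_l.
  have hr2 : 1 <= rho by apply: Rle_trans (Rmax_l _ _); apply: Rmax_r.
  have hr3 : b + 1 <= rho by apply: Rmax_r.
  have [|n [h [sh [hfar hball]]]] := sep rho; first lra.
  have hfx y : h y -> rho <= d x y by apply: hfar.
  have nhx : ~ h x by move=> /hfx; rewrite dist_xx; lra.
  exists (h :: ks); split; first by rewrite /= hlen.
  split; last first.
    move=> k [<-|/hks //]; split=> //; split=> //.
    have [c hc] : exists c, forall j, exists2 y, cl (compl h) y & d y (p j) <= c.
      apply: NNPP => hc; apply: hn; exists h; split=> //; split.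
        by move=> a y Ca hy; have := hfar a y Ca hy; lra.
      move=> c; apply: NNPP => hnn; apply: hc; exists c => j.
      apply: NNPP => hj; apply: hnn; exists j => y hy; apply: Rnot_le_lt => hle.
      by apply: hj; exists y.
    exists (Rmax c (d x (p n))), n; split; first by apply: hball; rewrite dist_xx; lra.
    split; first exact: Rmax_r.
    by move=> j; have [y hy hd] := hc j; exists y => //; apply: Rle_trans hd (Rmax_l _ _).
  (* The choice [b + 1 <= rho] serves two quadrants: the ball about [p n] inside [h] reaches the
     complement of [k], and the point [p j] of [k] is too close to [x] to be in [h]. *)
  constructor=> //; apply/Forall_forall => k hk.
  have [sk [nkx _]] := hks k hk; have [j [kj [dj hkb]]] := hb k hk.
  split; first exact: sigma_meet.
  split.
    have [c hc hd] := hkb n; have [y nky hy] := hc 1 Rlt_0_1.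
    exists y; split=> //; apply: hball.
    have := dist_tri (p n) c y; have := dist_sym c (p n); lra.
  split; last by exists x.
  by exists (p j); split=> // /hfx; lra.
have [ks [hlen [htr hks]]] := build (S r).
have := rank_list ks _ htr; rewrite hlen => hle.
suff : (S r <= r)%nat by lia.
by apply: hle => k /hks [/sigma_half].
Qed.

Lemma thick_chain : unbounded_from (eq x) ->
  exists h : nat -> X -> Prop, forall n, sigma (h n) /\ ~ h n x /\ (exists j, h n (p j)) /\
    far 1 (compl (h n)) (h (S n)) /\ exists z, h n z /\ ~ h (S n) z.
Proof.
move=> hun.
have [||h0 [sh0 [far0 un0]]] := thick_step (eq x) 1 _ _ eq_refl hun.
- exact: convex_point.
- exact: closed_point.
have n0 : ~ h0 x by move=> hx; have := far0 x x eq_refl hx; rewrite dist_xx; lra.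
have [||h [_ hh]] := dependent_choice
    (fun h => sigma h /\ ~ h x /\ unbounded_from (cl (compl h)))
    (fun h k => far 1 (compl h) k /\ exists z, h z /\ ~ k z) h0.
- by [].
- move=> h [sh [nhx hu]].
  have [j hj] := hu 0.
  have hpj : h (p j).
    by apply: NNPP => nh; have := hj (p j) (cl_sub _ _ nh); rewrite dist_xx; lra.
  (* The second entry pushes [k] beyond [p j], a point of [h], so the inclusion is strict. *)
  have [||||k [sk [fark unk]]] := thick_step (cl (compl h)) (Rmax 1 (d x (p j) + 1)).
  - by apply: cl_convex; case: (sigma_half _ sh) => _ [_ []].
  - exact: cl_closed.
  - exact: cl_sub.
  - by [].
  have hfx y : k y -> d x (p j) + 1 <= d x y.
    move=> ky; have := fark x y (cl_sub _ _ nhx) ky.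
    by have := Rmax_r 1 (d x (p j) + 1); lra.
  exists k; split; first split=> //.
    by split=> // kx; have := hfx x kx; rewrite dist_xx; have := dist_ge0 x (p j); lra.
  split; last by exists (p j); split=> // /hfx; lra.
  move=> a y na ky; have := fark a y (cl_sub _ _ na) ky.
  by have := Rmax_l 1 (d x (p j) + 1); lra.
exists h => n; have [[sh [nhx hu]] [hf hz]] := hh n; split=> //; split=> //; split=> //.
have [j hj] := hu 0; exists j; apply: NNPP => nh.
by have := hj (p j) (cl_sub _ _ nh); rewrite dist_xx; lra.
Qed.

(* Pull the chain [h] back to halfspaces [k] separating [x] from one of its neighbours in the orbit.
   If nothing is skewered the [k n] can be assumed to decrease, and their distances to [x] converge;
   then the translates [T u] of one far [k q] are pairwise transverse, because [T u] is too close
   to the complement of [h (a u)] to lie in [h (a v)]. *)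
Lemma no_escape : ~ unbounded_from (eq x).
Proof.
move=> /thick_chain [h hh].
have sh n : sigma (h n) by case: (hh n).
have nhx n : ~ h n x by case: (hh n) => _ [].
have far1 n : far 1 (compl (h n)) (h (S n)) by case: (hh n) => _ [_ [_ []]].
have hS n y : h (S n) y -> h n y.
  move=> hy; apply: NNPP => ny; have := far1 n y y ny hy; rewrite dist_xx; lra.
have hmono m n y : (m <= n)%nat -> h n y -> h m y by elim=> [//|k _ IH] /hS.
have cross n : exists gs, K (fst gs) /\ In (snd gs) gens /\ ~ h n (act (fst gs) x) /\
    h n (act (fst gs ** snd gs) x).
  have [|//|g [s hgs]] := orbit_crossing (h n); last by exists (g, s).
  apply: NNPP => hn; have [_ [_ [[j hj] _]]] := hh n.
  apply: (p_hull j (compl (h n))) => //; first by case: (sigma_half _ (sh n)) => _ [_ []].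
  by move=> g Kg hg; apply: hn; exists g.
pose gs n := proj1_sig (constructive_indefinite_description _ (cross n)).
have hgs n : K (fst (gs n)) /\ In (snd (gs n)) gens /\ ~ h n (act (fst (gs n)) x) /\
    h n (act (fst (gs n) ** snd (gs n)) x).
  exact: (proj2_sig (constructive_indefinite_description _ (cross n))).
pose g n := fst (gs n).
pose k n := tr (ginv (g n)) (h n).
have Kg n : K (g n) by case: (hgs n).
have [K1 [KM KV]] := generated_subgroup.
have hk n y : k n y <-> h n (act (g n) y) by rewrite /k /tr ginvK.
have nkx n : ~ k n x by move=> /hk; case: (hgs n) => _ [_ []].
have sk n : sigma (k n) by apply: H_sigma => //; apply: generated_H; apply: KV.
have trk n : tr (g n) (k n) = h n by rewrite /k trVK.
have [b hb] : exists b, forall n, dist x (k n) <= b.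
  have [||b hb] := list_bound (fun s b => d x (act s x) <= b) gens.
  - by move=> s b c; lra.
  - by move=> s _; exists (d x (act s x)); lra.
  exists b => n; have [_ [h1 [_ h2]]] := hgs n.
  apply: Rle_trans (hb _ h1); apply: dist_le; first exact: sigma_convex.
  by apply/hk; rewrite -actM.
(* Otherwise the element carrying [k i] to [h i] and then back, followed by [g j], would map [h i]
   into [h j], hence skewer [h j]. *)
have nsub i j : (i < j)%nat -> ~ forall y, k i y -> k j y.
  move=> hij hsub.
  apply: (K_no_skewer (g j ** ginv (g i)) (h j)) => //; first by apply: (KM) => //; apply: KV.
  have hi y : h i y -> tr (g i ** ginv (g j)) (h j) y.
    by rewrite -(trk i) trM; apply: tr_mono.
  have e : tr (g j ** ginv (g i)) (tr (g i ** ginv (g j)) (h j)) = h j.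
    by rewrite -trM -gmulA ginv_mulK gVmul tr1.
  split.
    move=> y hy; rewrite -e; apply: (tr_mono _ (h j)) hy => t ht; apply: hi.
    by apply: hmono ht; lia.
  have [_ [_ [_ [_ [z [hz nz]]]]]] := hh i.
  exists (act (g j ** ginv (g i)) z); split.
    by rewrite -e; apply: tr_act; apply: hi.
  by move=> /tr_act_inv hz'; apply: nz; apply: hmono hz'; lia.
have [phi [hphi hdesc]] : exists phi, increasing phi /\
    forall i j, (i < j)%nat -> forall y, k (phi j) y -> k (phi i) y.
  apply: (ramsey r (fun i j => forall y, k j y -> k i y)) => phi hphi hbad.
  apply: (Hr (fun i => k (phi i))) => [i _|i j hij]; first exact: sigma_half.
  split; first exact: sigma_meet.
  split.
    apply: NNPP => hn; apply: (nsub (phi i) (phi j)); first by apply: increasing_lt => //; lia.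
    by move=> y ky; apply: NNPP => ny; apply: hn; exists y.
  split; last by exists x.
  apply: NNPP => hn; apply: (hbad i j) => // y ky.
  by apply: NNPP => ny; apply: hn; exists y.
have kdesc i j y : (i <= j)%nat -> k (phi j) y -> k (phi i) y.
  by move=> hij; have [->//|hlt] : i = j \/ (i < j)%nat by [lia]; apply: hdesc.
have dmono i j : (i <= j)%nat -> dist x (k (phi i)) <= dist x (k (phi j)).
  move=> hij; apply: dist_mono; try exact: sigma_convex; first by case: (sigma_half _ (sk (phi j))).
  by move=> y; apply: kdesc.
have [||m [hm happ]] := infimum (fun t => exists n, t = b - dist x (k (phi n))).
- by exists (b - dist x (k (phi 0%nat))), 0%nat.
- by move=> t [n ->]; have := hb (phi n); lra.
have [t [[i0 ->] hi0]] := happ 1 Rlt_0_1.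
have hclose j : dist x (k (phi j)) < dist x (k (phi i0)) + 1.
  by have := hm _ (ex_intro _ j eq_refl); lra.
(* The factor 2 makes consecutive values of [a] differ by at least two: one layer of the chain
   supplies the point for [dist_gap], the next its gap of 1, the amount that [hclose] forbids. *)
pose a t := phi (i0 + 2 * t)%nat.
pose q := phi (i0 + 2 * r)%nat.
pose T t := tr (g (a t)) (k q).
have KT u v : K (g (a u) ** ginv (g (a v))) by apply: (KM) => //; apply: KV.
have ET u v : T u = tr (g (a u) ** ginv (g (a v))) (T v) by rewrite /T trM trK.
have sT u : sigma (T u) by apply: H_sigma => //; apply: generated_H.
have Th u y : (u <= r)%nat -> T u y -> h (a u) y.
  by move=> hu; rewrite -(trk (a u)); apply: tr_mono => z; apply: kdesc; lia.
have eqT u v : (forall y, T u y -> T v y) -> forall y, T v y -> T u y.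
  move=> hsub y hy; apply: NNPP => hn.
  apply: (K_no_skewer _ _ (KT u v) (sT v)); split; rewrite -ET //.
  by exists y.
have hlt u v : (u < v <= r)%nat -> ~ forall y, T u y -> T v y.
  move=> huv hsub.
  have hav : (S (S (phi (i0 + 2 * u))) <= a v)%nat.
    have := increasing_lt phi (i0 + 2 * u) (S (i0 + 2 * u)) hphi ltac:(lia).
    have := increasing_lt phi (S (i0 + 2 * u)) (i0 + 2 * v) hphi ltac:(lia).
    by rewrite /a; lia.
  have nh : ~ h (a u) (act (g (a u)) x) by case: (hgs (a u)) => _ [_ []].
  have [_ [_ [_ [_ [z [hz nz]]]]]] := hh (a u).
  have gap : dist (act (g (a u)) x) (h (a u)) + 1 <= dist (act (g (a u)) x) (h (a v)).
    apply: (dist_gap (h (a u)) (h (S (a u))) (h (a v)) z) => //.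
    - exact: sigma_convex.
    - by case: (sigma_half _ (sh (S (a u)))) => _ [_ []].
    - exact: sigma_convex.
    - by case: (sigma_half _ (sh (a v))).
    - by move=> y; apply: hmono; lia.
    - by move=> y hy; apply: hmono hy; rewrite /a in hav *; lia.
    - by move=> c y nc hy; apply: (far1 (S (a u))) => //; apply: hmono hy.
  have h1 : dist (act (g (a u)) x) (h (a v)) <= dist (act (g (a u)) x) (T u).
    apply: dist_mono; try exact: sigma_convex; first by case: (sigma_half _ (sT u)).
    by move=> y /hsub; apply: Th; lia.
  have e1 : dist (act (g (a u)) x) (T u) = dist x (k q).
    by apply: dist_tr; [exact: sigma_convex|case: (sigma_half _ (sk q))].
  have e2 : dist (act (g (a u)) x) (h (a u)) = dist x (k (a u)).
    by rewrite -(trk (a u)); apply: dist_tr; [exact: sigma_convex|case: (sigma_half _ (sk (a u)))].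
  have := hclose (i0 + 2 * r)%nat; have := dmono i0 (i0 + 2 * u)%nat ltac:(lia).
  by rewrite -/q -/(a u); lra.
apply: (Hr T) => [u _|u v huv]; first exact: sigma_half.
split; first exact: sigma_meet.
split.
  apply: NNPP => hn; apply: (hlt u v huv) => y hy.
  by apply: NNPP => ny; apply: hn; exists y.
split.
  apply: NNPP => hn; apply: (hlt u v huv); apply: eqT => y hy.
  by apply: NNPP => ny; apply: hn; exists y.
by exists x; split=> hx; [apply: (nhx (a u)); apply: Th hx; lia|apply: (nhx (a v)); apply: Th hx; lia].
Qed.

End Descent.

Lemma generators_fixed_point : exists y, forall g, K g -> act g y = y.
Proof.
have [p [h1 [h2 [h3 h4]]]] := descending_orbit.
suff [y hy] : exists y, forall s, In s gens -> act s y = y.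
  exists y => g Kg; apply: (Kg (fun g => act g y = y)) => //.
  split; first exact: act1.
  by split=> [a b ha hb|a ha]; [rewrite actM hb|rewrite -{1}ha actK].
case: (classic (unbounded_from p (eq x))) => [hu|hb]; first by case: (no_escape p h1 h2 h4).
have [b /not_ex_all_not hb'] := not_all_ex_not _ _ hb.
apply: (bounded_fixed p h1 h2 h3 b) => n; apply: Rnot_lt_le => hlt.
by apply: (hb' n) => c <-.
Qed.

End FixedPoint.

Lemma commutator_fixed_point (x : X) (l : list G) :
  (forall g, In g l -> commutator_subgroup G end_stabiliser g) ->
  exists y, forall g, generated G l g -> act g y = y.
Proof.
move=> hl.
have [sS _] := end_stabiliser_index x.
have cN : subgroup G (commutator_subgroup G end_stabiliser) by apply: commutator_is_subgroup.
have NH g : commutator_subgroup G end_stabiliser g -> H g.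
  by move=> /(commutator_sub _ _ sS g) [].
set gens := l ++ map ginv l.
have hgens g : In g gens -> commutator_subgroup G end_stabiliser g.
  move=> /(in_app_or _ _ _) [/hl //|/in_map_iff [k [<- /hl hk]]].
  by apply cN.
have genN g : generated G gens g -> commutator_subgroup G end_stabiliser g.
  by move=> hg; apply: hg.
have [|||y hy] := generators_fixed_point gens x.
- by move=> s /hgens /NH.
- move=> s /(in_app_or _ _ _) [hs|/in_map_iff [k [<- hk]]]; apply: in_or_app.
    by right; apply: in_map.
  by left; rewrite ginvK.
- by move=> g h /genN hg sh; apply: commutator_no_skewer.
exists y => g hg; apply: hy => L hL hS; apply: hg => // k hk; apply: hS.
by apply: in_or_app; left.
Qed.

End Boundary.

(** * An ultrafilter fixed by a finite-index subgroup *)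

Lemma last_cons {T : Type} (l : list T) a b : last (a :: l) b = last l a.
Proof. by elim: l a b => [//|c l IH] a b; rewrite [RHS]IH -(IH c b). Qed.

(** [A c] is the repelling set of the letter [c]. A reduced word sends the complement of the
    repelling set of its last letter into that of the inverse of its first letter; one of the four
    sets differs from both, and its points are moved. *)
Lemma ping_pong (a b : G) (A : bool * bool -> X -> Prop) :
  (forall c, exists x, A c x) -> (forall c c' x, A c x -> A c' x -> c = c') ->
  (forall c x, ~ A c x -> A (fst c, negb (snd c)) (act (letter_eval G a b c) x)) ->
  has_nonabelian_free_subgroup G.
Proof.
move=> ne dj hA; exists a, b => -[//|c w] _ hred e.
have key : forall w c, reduced (c :: w) -> forall x, ~ A (last w c) x ->
    A (fst c, negb (snd c)) (act (word_eval G a b (c :: w)) x).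
  elim=> [|c2 w2 IH] c1 hr x hx /=; first by rewrite gmul1r; apply: hA.
  move: hr => [h12 hr]; rewrite actM; apply: hA => hc1.
  have hx' : ~ A (last w2 c2) x by rewrite -(last_cons w2 c2 c1).
  have e12 := dj _ _ _ hc1 (IH c2 hr x hx'); apply: h12.
  by rewrite e12 /=.
have [c' [h1 h2]] : exists c', c' <> last w c /\ c' <> (fst c, negb (snd c)).
  case: (last w c) (fst c, negb (snd c)) => [[|] [|]] [[|] [|]];
  first [by exists (true, true) | by exists (true, false) | by exists (false, true)
        | by exists (false, false)].
have [x hx] := ne c'.
have hlast : ~ A (last w c) x by move=> h; apply: h1; apply: dj h.
have := key w c hred x hlast; rewrite e act1 => h.
by apply: h2; apply: dj h.
Qed.

Lemma compl_compl h : compl (compl h) = h.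
Proof. by apply: pred_ext => x; split; [apply: NNPP|move=> hx; apply]. Qed.

Definition disj (h k : X -> Prop) : Prop := forall x, h x -> k x -> False.

Definition sub (h k : X -> Prop) : Prop := forall x, h x -> k x.

Lemma not_meet_disj h k : ~ (exists x, h x /\ k x) -> disj h k.
Proof. by move=> hn x hx kx; apply: hn; exists x. Qed.

Definition invariant_filter (F : (X -> Prop) -> Prop) : Prop :=
  (forall h, F h -> halfspace X d h) /\ (forall h k, F h -> F k -> exists x, h x /\ k x) /\
  (forall g h, F h -> F (tr g h)).

Lemma maximal_invariant_filter : exists F, invariant_filter F /\
  forall F', invariant_filter F' -> (forall h, F h -> F' h) -> forall h, F' h -> F h.
Proof.
have [|Ch _ hCh htot|F [h1 [_ h2]]] := zorn_above invariant_filter (fun _ => False).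
- by split=> [h []|]; split=> [h k []|g h []].
- split=> [h [F /hCh [h1 _]]|]; first exact: h1.
  split=> [h k [F1 c1 f1] [F2 c2 f2]|g h [F c f]].
    have [_ [m1 _]] := hCh _ c1; have [_ [m2 _]] := hCh _ c2.
    by case: (htot _ _ c1 c2) => hs; [apply: m2; auto|apply: m1; auto].
  by exists F => //; have [_ [_ hF]] := hCh _ c; apply: hF.
by exists F.
Qed.

Section Core.
Variable F : (X -> Prop) -> Prop.
Hypothesis F_filter : invariant_filter F.
Hypothesis F_max : forall F', invariant_filter F' -> (forall h, F h -> F' h) -> forall h, F' h -> F h.

Lemma adjoin h : halfspace X d h -> (forall f g, F f -> exists x, f x /\ tr g h x) ->
  (forall g g', exists x, tr g h x /\ tr g' h x) -> F h.
Proof.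
move=> hh h1 h2; have [f1 [f2 f3]] := F_filter.
apply: (F_max (fun k => F k \/ exists g, k = tr g h)); last by right; exists gone; rewrite tr1.
  split=> [k [/f1 //|[g ->]]|]; first exact: tr_halfspace.
  split=> [k k' [fk|[g ->]] [fk'|[g' ->]]|g k [fk|[g' ->]]] //; first exact: f2.
  - exact: h1.
  - by have [x [hx hx']] := h1 k' g fk'; exists x.
  - by left; apply: f3.
  by right; exists (g ** g'); rewrite trM.
by move=> k fk; left.
Qed.

Lemma F_up f k : F f -> halfspace X d k -> sub f k -> F k.
Proof.
have [f1 [f2 f3]] := F_filter => ff hk hs; apply: adjoin => // [f' g ff'|g g'].
  by have [x [hx hx']] := f2 f' (tr g f) ff' (f3 g f ff); exists x; split=> //; apply: hs.
by have [x [hx hx']] := f2 _ _ (f3 g f ff) (f3 g' f ff); exists x; split; apply: hs.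
Qed.

(* The halfspaces left undecided by [F]. *)
Definition core (h : X -> Prop) : Prop := halfspace X d h /\ ~ F h /\ ~ F (compl h).

Lemma core_half h : core h -> halfspace X d h.
Proof. by case. Qed.

Lemma core_compl h : core h -> core (compl h).
Proof. by move=> [h1 [h2 h3]]; split; [apply: halfspace_compl|rewrite compl_compl]. Qed.

Lemma core_tr g h : core h -> core (tr g h).
Proof.
have [_ [_ f3]] := F_filter => -[h1 [h2 h3]]; split; first exact: tr_halfspace.
split=> hF; [apply: h2; rewrite -(trK g h); exact: f3|apply: h3; rewrite -(trK g (compl h)); exact: f3].
Qed.

(** Only two things can prevent adjoining the translates of [compl h] to [F]. A translate disjoint
    from a member of [F] would put [h] into [F]; so two translates of [compl h] are disjoint, and
    this is the flip. *)
Lemma core_flip h : core h -> exists g, forall x, ~ h x -> h (act g x).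
Proof.
move=> /core_compl [hh [nF nFc]]; apply: NNPP => hn; apply: nF; apply: adjoin => //.
  move=> f g ff; apply: NNPP => hdisj; apply: nFc.
  have [f1 [f2 f3]] := F_filter.
  apply: (F_up (tr (ginv g) f)); [exact: f3|exact: halfspace_compl|].
  move=> x; rewrite /tr ginvK => hx hcx; apply: hdisj; exists (act g x); split=> //.
  exact: (tr_act g (compl h)).
move=> g g'; apply: NNPP => hdisj; apply: hn; exists (ginv g' ** g) => x nhx.
apply: NNPP => nh'; apply: hdisj; exists (act g x); split; first exact: (tr_act g (compl h)).
by rewrite /tr -actM.
Qed.

Lemma core_skewer h k : core h -> core k -> disj h k -> exists s, forall x, ~ h x -> k (act s x).
Proof.
move=> /core_flip [g hg] /core_flip [g' hg'] hd; exists (g' ** g) => x /hg hx.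
by rewrite actM; apply: hg' => /(hd _ hx).
Qed.

Hypothesis no_free : ~ has_nonabelian_free_subgroup G.

(** The ping-pong pair is [s], which sends the complement of [h1] into [h2], and its conjugate by a
    flip of [h3], whose two sets then lie inside [h3]. *)
Lemma no_facing_triple h1 h2 h3 : core h1 -> core h2 -> core h3 ->
  disj h1 h2 -> disj h1 h3 -> disj h2 h3 -> False.
Proof.
move=> c1 c2 c3 d12 d13 d23.
have [s hs] := core_skewer h1 h2 c1 c2 d12; have [g hg] := core_flip h3 c3.
have hs' x : ~ h2 x -> h1 (act (ginv s) x).
  by move=> nx; apply: NNPP => /hs; rewrite actVK.
have t1 x : tr g h1 x -> h3 x by move=> hx; rewrite -(actVK g x); apply: hg => /(d13 _ hx).
have t2 x : tr g h2 x -> h3 x by move=> hx; rewrite -(actVK g x); apply: hg => /(d23 _ hx).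
pose A (c : bool * bool) := match c with
  | (true, false) => h1 | (true, true) => h2 | (false, false) => tr g h1 | (false, true) => tr g h2 end.
apply: no_free; apply: (ping_pong s (g ** s ** ginv g) A).
- have [[x1 hx1] _] := core_half _ c1; have [[x2 hx2] _] := core_half _ c2.
  by move=> [[|] [|]];
    [exists x2|exists x1|exists (act g x2); apply: tr_act|exists (act g x1); apply: tr_act].
- have e12 x : h1 x -> h2 x -> (true, false) = (true, true) by move=> a b; case: (d12 x a b).
  by move=> [[|] [|]] [[|] [|]] x //= a b; exfalso;
    first [exact: (d12 _ a b)|exact: (d12 _ b a)|exact: (d13 _ a (t1 _ b))|exact: (d13 _ a (t2 _ b))
    |exact: (d13 _ b (t1 _ a))|exact: (d13 _ b (t2 _ a))|exact: (d23 _ a (t1 _ b))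
    |exact: (d23 _ a (t2 _ b))|exact: (d23 _ b (t1 _ a))|exact: (d23 _ b (t2 _ a))].
move=> [[|] [|]] x nx; rewrite /letter_eval /=.
- exact: hs'.
- exact: hs.
- by rewrite !ginvM ginvK !actM /tr actK; apply: hs'.
by rewrite !actM /tr actK; apply: hs.
Qed.

(* A skewering [s] with [s k1] inside [k0] also carries [k2] into [k0]; by finite rank two of the
   translates [gpow s n k2] are nested, so some translate lies in [k2] or contains it. *)
Lemma confluence k0 k1 k2 : core k0 -> core k1 -> core k2 -> sub k0 k1 -> sub k2 k1 ->
  exists j, core j /\ sub j k0 /\ sub j k2.
Proof.
move=> c0 c1 c2 s01 s21; apply: NNPP => hn.
have [|s hs] := core_skewer (compl k1) k0 (core_compl _ c1) c0; first by move=> x h /s01.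
have hs0 x : tr s k1 x -> k0 x by move=> hx; rewrite -(actVK s x); apply: hs; apply.
have hs1 x : tr s k1 x -> k1 x by move=> /hs0 /s01.
pose K n := tr (gpow s n) k2.
have cK n : core (K n) by apply: core_tr.
have K1 n : sub (K n) k1.
  move=> x hx; rewrite -(tr1 k1); apply: (gpow_decr s k1 hs1 0 n); [lia|exact: tr_mono hx].
have K0 n : (0 < n)%nat -> sub (K n) k0.
  move=> hpos x hx; apply: hs0; rewrite -(gmul1r _ s).
  by apply: (gpow_decr s k1 hs1 1 n) => //; apply: tr_mono hx.
have e i j : (i < j)%nat -> K j = tr (gpow s i) (K (j - i)%nat).
  by move=> hij; rewrite /K -trM -gpowD; have -> : (i + (j - i) = j)%nat by lia.
have c1' := core_compl _ c1.
apply: (Hr K) => [i _|i j hij]; first exact: core_half.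
split.
  apply: NNPP => /not_meet_disj dij.
  by apply: (no_facing_triple (K i) (K j) (compl k1)) => // x /K1 h; apply.
split.
  apply: NNPP => hsub; apply: hn; exists k2; split=> //; split=> // x hx.
  apply: (K0 (j - i)%nat); first lia.
  apply: (tr_act_inv (gpow s i)); rewrite -(e i j); last lia.
  by apply: NNPP => hj; apply: hsub; exists (act (gpow s i) x); split=> //; apply: tr_act.
split.
  apply: NNPP => hsub; apply: hn; exists (K (j - i)%nat); split=> //; split; first by apply: K0; lia.
  move=> x hx; apply: (tr_act_inv (gpow s i)); apply: NNPP => hi; apply: hsub.
  by exists (act (gpow s i) x); split=> //; rewrite (e i j); [apply: tr_act|lia].
by have [_ [[x nx] _]] := core_half _ c1; exists x; split=> /K1.
Qed.

(** Having a common refinement in the core; transitivity is exactly [confluence]. *)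
Definition equiv (h k : X -> Prop) : Prop := exists j, core j /\ sub j h /\ sub j k.

Lemma equiv_sym h k : equiv h k -> equiv k h.
Proof. by move=> [j [c [h1 h2]]]; exists j. Qed.

Lemma equiv_trans h k l : core k -> equiv h k -> equiv k l -> equiv h l.
Proof.
move=> ck [i [ci [ih ik]]] [j [cj [jk jl]]].
have [m [cm [mi mj]]] := confluence i k j ci ck cj ik jk.
by exists m; split=> //; split=> x /= hx; [apply/ih/mi|apply/jl/mj].
Qed.

Lemma equiv_meet h k : equiv h k -> exists x, h x /\ k x.
Proof. by move=> [j [/core_half [[x hx] _] [h1 h2]]]; exists x; auto. Qed.

Lemma equiv_compl h k : core h -> core k -> equiv h k -> equiv (compl h) (compl k).
Proof.
move=> ch ck [j [cj [jh jk]]].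
apply: (confluence (compl h) (compl j) (compl k)); try exact: core_compl.
  by move=> x nx /jh.
by move=> x nx /jk.
Qed.

Lemma disj_equiv h k : core h -> disj h k -> equiv h (compl k).
Proof. by move=> ch hd; exists h; split=> //; split=> // x hx kx; apply: hd hx kx. Qed.

Lemma unrelated_transverse h k : core h -> core k -> ~ (equiv h k \/ equiv h (compl k)) ->
  transverse X h k.
Proof.
move=> ch ck hn.
split; first by apply: NNPP => /not_meet_disj hd; apply: hn; right; apply: disj_equiv.
split.
  apply: NNPP => hd; apply: hn; left; rewrite -(compl_compl k); apply: disj_equiv => // x hx kx.
  by apply: hd; exists x.
split.
  apply: NNPP => hd; apply: hn; left; apply: equiv_sym; rewrite -(compl_compl h).
  by apply: disj_equiv => // x kx hx; apply: hd; exists x.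
apply: NNPP => hd; apply: hn; right; apply: equiv_sym; rewrite -(compl_compl h).
by apply: disj_equiv; [apply: core_compl|move=> x kx hx; apply: hd; exists x].
Qed.

Definition cls (h k : X -> Prop) : Prop := core k /\ equiv h k.

Lemma cls_eq h k : core h -> core k -> equiv h k -> cls h = cls k.
Proof.
move=> ch ck e; apply: pred_ext => l; split=> -[cl' e']; split=> //.
  by apply: (equiv_trans k h) => //; apply: equiv_sym.
exact: (equiv_trans h k).
Qed.

Lemma cls_tr g h : trF g (cls h) = cls (tr g h).
Proof.
apply: pred_ext => k; rewrite /trF /cls; split=> -[ck [j [cj [h1 h2]]]].
  split; first by rewrite -(trVK g k); apply: core_tr.
  exists (tr g j); split; first exact: core_tr.
  by split; [apply: tr_mono|rewrite -(trVK g k); apply: tr_mono].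
split; first exact: core_tr.
exists (tr (ginv g) j); split; first exact: core_tr.
by split; [rewrite -(trK g h); apply: tr_mono|apply: tr_mono].
Qed.

Lemma fixed_ultrafilter : exists (sigma : (X -> Prop) -> Prop) (H : G -> Prop),
  (forall h, sigma h -> halfspace X d h) /\
  (forall h k, sigma h -> sigma k -> exists x, h x /\ k x) /\
  (forall h, halfspace X d h -> sigma h \/ sigma (compl h)) /\
  finite_index G H /\ (forall g h, H g -> sigma h -> sigma (tr g h)).
Proof.
have [f1 [f2 f3]] := F_filter.
have [l hl hp|l [hl [hp hcov]]] := maximal_unrelated core (fun h k => equiv h k \/ equiv h (compl k)) r.
  apply: rank_list => [h /hl /core_half //|].
  elim: hp hl => [|h l' hh _ IH] hl; constructor; last by apply: IH => k hk; apply: hl; right.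
  apply/Forall_forall => k hk; move/Forall_forall: hh => /(_ k hk).
  by apply: unrelated_transverse; apply: hl; [left|right].
pose is_cls C := exists h, core h /\ C = cls h.
pose sigma k := F k \/ exists h, In h l /\ core k /\ equiv h k.
(* The list only controls ordered pairs; [equiv_compl] symmetrises this, and the diagonal case fails
   because equivalent halfspaces meet. *)
have unrel h k : In h l -> In k l -> ~ equiv h (compl k).
  move=> hin kin e; have ch := hl h hin; have ck := hl k kin.
  have := equiv_compl _ _ ch (core_compl _ ck) e; rewrite compl_compl => /equiv_sym e'.
  have hneq : h <> k by move=> ehk; rewrite ehk in e; have [x [? ?]] := equiv_meet _ _ e.
  elim: hp hin kin {hl hcov} => [//|a l' ha _ IH] /= [ea|hin] [ea'|kin].
  - by apply: hneq; rewrite -ea.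
  - by move/Forall_forall: ha => /(_ k kin); apply; rewrite ea; right.
  - by move/Forall_forall: ha => /(_ h hin); apply; rewrite ea'; right.
  exact: IH.
exists sigma, (fun g => True /\ forall C, is_cls C -> trF g C = C).
split; first by move=> h [/f1 //|[k [_ [/core_half]]]].
split.
  have mixed f k : F f -> core k -> exists x, f x /\ k x.
    move=> ff [hk [_ nk]]; apply: NNPP => /not_meet_disj hd; apply: nk.
    by apply: (F_up f) => //; apply: halfspace_compl.
  move=> h k [fh|[a [al [ch eh]]]] [fk|[b [bl [ck ek]]]]; first exact: f2.
  - exact: mixed.
  - by have [x [? ?]] := mixed k h fk ch; exists x.
  apply: NNPP => /not_meet_disj /(disj_equiv _ _ ch) e; apply: (unrel a b al bl).
  apply: (equiv_trans _ h) => //; apply: (equiv_trans _ (compl k)); [exact: core_compl|exact: e|].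
  by apply: equiv_compl; auto; apply: equiv_sym.
split.
  move=> h hh; case: (classic (F h)) => fh; first by left; left.
  case: (classic (F (compl h))) => fh'; first by right; left.
  have ch : core h by [].
  have [k kl [e|e]] := hcov h ch.
    by left; right; exists k; split=> //; split=> //; apply: equiv_sym.
  right; right; exists k; split=> //; split; first exact: core_compl.
  apply: equiv_sym; rewrite -(compl_compl k); apply: equiv_compl => //.
  by apply: core_compl; apply: hl.
split.
  apply: (finite_index_stabiliser G trF (fun _ => True) is_cls).
  - exact: trF1.
  - exact: trFM.
  - by split; [|exists (gone :: nil) => g; exists gone; split=> //; left].
  - by move=> g C _ [h [ch ->]]; exists (tr g h); split; [apply: core_tr|apply: cls_tr].
  exists (map cls l ++ map (fun h => cls (compl h)) l) => C [h [ch ->]].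
  have [k kl [e|e]] := hcov h ch; apply: in_or_app; [left|right]; apply/in_map_iff; exists k; split=> //.
    by symmetry; apply: cls_eq => //; apply: hl.
  by symmetry; apply: cls_eq => //; apply: core_compl; apply: hl.
move=> g h [_ hg] [fh|[k [kl [ch e]]]]; first by left; apply: f3.
right; exists k; split=> //.
have := hg (cls k) (ex_intro _ k (conj (hl k kl) eq_refl)) => e'.
have : cls k (tr g h) by rewrite -e' /trF trK.
by [].
Qed.

End Core.

Lemma locally_elliptic_commutators (x : X) : ~ has_nonabelian_free_subgroup G ->
  exists H, finite_index G H /\ forall l, (forall g, In g l -> commutator_subgroup G H g) ->
    exists y, forall g, generated G l g -> act g y = y.
Proof.
move=> nf; have [F [hF hmax]] := maximal_invariant_filter.
have [sigma [H [h1 [h2 [h3 [h4 h5]]]]]] := fixed_ultrafilter F hF hmax nf.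
exists (end_stabiliser sigma H); split; first exact: end_stabiliser_index.
exact: commutator_fixed_point.
Qed.

End Space.

(** * Amenability *)

Lemma ultrafilter_ex {J : Type} (le : J -> J -> Prop) (j0 : J) :
  (forall j, le j j) -> (forall i j k, le i j -> le j k -> le i k) ->
  (forall i j, exists k, le i k /\ le j k) ->
  exists U : (J -> Prop) -> Prop,
    (forall A B : J -> Prop, U A -> (forall x, A x -> B x) -> U B) /\
    (forall A B : J -> Prop, U A -> U B -> U (fun x => A x /\ B x)) /\
    (forall A : J -> Prop, U A -> exists x, A x) /\
    (forall A : J -> Prop, U A \/ U (fun x => ~ A x)) /\ forall j, U (le j).
Proof.
move=> refl trans dir.
pose F (A : J -> Prop) := exists j, forall k, le j k -> A k.
have PF : filter.ProperFilter F.
  apply: filter.Build_ProperFilter; first by move=> [j hj]; apply: (hj j).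
  apply: filter.Build_Filter.
  - by exists j0.
  - move=> A B [i hi] [j hj]; have [k [ik jk]] := dir i j; exists k => m km.
    by split; [apply: hi|apply: hj]; apply: trans km.
  by move=> A B AB [j hj]; exists j => k jk; apply/AB/hj.
have [U [UU FU]] := filter.ultraFilterLemma PF.
have PU := @filter.ultra_proper _ _ UU.
have FiU := @filter.filter_filter _ _ PU.
exists U; split; first by move=> A B hA hAB; apply: (@filter.filterS _ _ FiU A B).
split; first by move=> A B hA hB; apply: (@filter.filterI _ _ FiU A B).
split.
  move=> A hA; apply: NNPP => hn; apply: (@filter.filter_not_empty _ _ PU).
  by apply: (@filter.filterS _ _ FiU A) hA => x hx; apply: hn; exists x.
split; first by move=> A; apply: filter.in_ultra_setVsetC.
by move=> j; apply: FU; exists j.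
Qed.

Section Ultralimit.
Variables (J : Type) (U : (J -> Prop) -> Prop).
Hypothesis U_up : forall A B : J -> Prop, U A -> (forall x, A x -> B x) -> U B.
Hypothesis U_and : forall A B : J -> Prop, U A -> U B -> U (fun x => A x /\ B x).
Hypothesis U_ne : forall A : J -> Prop, U A -> exists x, A x.
Hypothesis U_ultra : forall A : J -> Prop, U A \/ U (fun x => ~ A x).

Definition ulim (u : J -> R) (l : R) : Prop := forall e, 0 < e -> U (fun j => Rabs (u j - l) < e).

Lemma ulim_ex u : (forall j, 0 <= u j <= 1) -> exists l, ulim u l.
Proof.
move=> hu; have UT : U (fun _ => True).
  by case: (U_ultra (fun _ => True)) => // h; apply: U_up h _.
have [||l [ub lub]] := completeness (fun t => U (fun j => t <= u j)).
- exists 1 => t /U_ne [j hj]; have := hu j; lra.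
- by exists 0; apply: U_up UT _ => j _; have := hu j; lra.
exists l => e he.
have [t [Ut ht]] : exists t, U (fun j => t <= u j) /\ l - e < t.
  apply: NNPP => hn; suff : l <= l - e by lra.
  by apply: lub => t Ut; apply: Rnot_lt_le => h; apply: hn; exists t.
have hU : U (fun j => ~ (l + e / 2 <= u j)).
  by case: (U_ultra (fun j => l + e / 2 <= u j)) => // /ub; lra.
apply: U_up (U_and _ _ Ut hU) _ => j [h1 h2].
by apply: Rabs_def1; lra.
Qed.

Lemma ulim_close u v l m b : (forall e, 0 < e -> U (fun j => Rabs (u j - v j) <= b + e)) ->
  ulim u l -> ulim v m -> Rabs (l - m) <= b.
Proof.
move=> huv hu hv; apply: le_epsilon => e he.
have he3 : 0 < e / 3 by lra.
have [j [h1 [h2 h3]]] := U_ne _ (U_and _ _ (huv _ he3) (U_and _ _ (hu _ he3) (hv _ he3))).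
have -> : l - m = - (u j - l) + ((u j - v j) + (v j - m)) by ring.
apply: Rle_trans (Rabs_triang _ _) _; rewrite Rabs_Ropp.
have := Rabs_triang (u j - v j) (v j - m); lra.
Qed.

Lemma ulim_add u v l m : ulim u l -> ulim v m -> ulim (fun j => u j + v j) (l + m).
Proof.
move=> hu hv e he; have he2 : 0 < e / 2 by lra.
apply: U_up (U_and _ _ (hu _ he2) (hv _ he2)) _ => j [h1 h2].
have -> : u j + v j - (l + m) = (u j - l) + (v j - m) by ring.
by apply: Rle_lt_trans (Rabs_triang _ _) _; lra.
Qed.

Lemma ulim_const c : ulim (fun _ => c) c.
Proof.
move=> e he; case: (U_ultra (fun _ => Rabs (c - c) < e)) => // /U_ne [_].
by rewrite Rminus_diag Rabs_R0.
Qed.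

Lemma ulim_ge0 u l : (forall j, 0 <= u j) -> ulim u l -> 0 <= l.
Proof.
move=> h hu; apply: Rnot_lt_le => hl; have [|j hj] := U_ne _ (hu (- l) _); first lra.
by have := h j; have := Rle_abs (u j - l); lra.
Qed.

Lemma ulim_uniq u l m : ulim u l -> ulim u m -> l = m.
Proof.
move=> hu hv; have := ulim_close u u l m 0 _ hu hv => h.
have {}h : Rabs (l - m) <= 0.
  apply: h => e he; apply: U_up (hu e he) _ => j _; rewrite Rminus_diag Rabs_R0; lra.
by have := Rle_abs (l - m); have := Rle_abs (m - l); rewrite (Rabs_minus_sym m); lra.
Qed.

End Ultralimit.

(** * Almost invariant means on the space *)

Section InvariantMeans.
Variables (G : Group) (X : Type) (act : G -> X -> X).
Hypothesis act_one : forall x, act gone x = x.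
Hypothesis act_mul : forall g h x, act (g ** h) x = act g (act h x).

(** Unbounded functions are allowed: the means constructed are finite averages of Dirac masses, and
    ultralimits are taken only of their values on [unit_valued] functions. *)
Definition mean (M : (X -> R) -> R) : Prop :=
  (forall f g, M (fun x => f x + g x) = M f + M g) /\
  (forall f, (forall x, 0 <= f x) -> 0 <= M f) /\ M (fun _ => 1) = 1.

Definition unit_valued (f : X -> R) : Prop := forall x, 0 <= f x <= 1.

Lemma mean_unit M f : mean M -> unit_valued f -> 0 <= M f <= 1.
Proof.
move=> [Madd [Mpos M1]] hf; split; first by apply: Mpos => x; case: (hf x).
have : 0 <= M (fun x => 1 - f x) by apply: Mpos => x; have := hf x; lra.
have := Madd f (fun x => 1 - f x).
have -> : (fun x => f x + (1 - f x)) = (fun _ => 1) by apply: functional_extensionality => x; ring.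
rewrite M1; lra.
Qed.

Definition almost_invariant (e : R) (M : (X -> R) -> R) (g : G) : Prop :=
  forall f, unit_valued f -> Rabs (M (fun x => f (act g x)) - M f) <= e.

Definition lsum {T : Type} (F : T -> R) (l : list T) : R := fold_right (fun a s => F a + s) 0 l.

Lemma lsum_close {T : Type} (F F' : T -> R) l e : (forall a, In a l -> Rabs (F a - F' a) <= e) ->
  Rabs (lsum F l - lsum F' l) <= INR (length l) * e.
Proof.
elim: l => [|a l IH] h; first by rewrite /= Rminus_diag Rabs_R0; lra.
rewrite (S_INR (length l) : INR (length (a :: l)) = _) /lsum /= -/(lsum F l) -/(lsum F' l).
have -> : F a + lsum F l - (F' a + lsum F' l) = (F a - F' a) + (lsum F l - lsum F' l) by ring.
apply: Rle_trans (Rabs_triang _ _) _.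
have := h a (or_introl eq_refl); have := IH (fun b hb => h b (or_intror hb)); lra.
Qed.

Lemma lsum_perm {T : Type} (F : T -> R) l l' : Permutation l l' -> lsum F l = lsum F l'.
Proof.
elim=> [//|a m m' _ IH|a b m|m1 m2 m3 _ -> _ -> //]; rewrite /lsum /=.
  by rewrite -/(lsum F m) IH.
by ring.
Qed.

Lemma lsum_map {T T' : Type} (F : T' -> R) (s : T -> T') l :
  lsum F (map s l) = lsum (fun a => F (s a)) l.
Proof. by elim: l => [//|a l IH]; rewrite /lsum /= -/(lsum F (map s l)) IH. Qed.

Lemma lsum_telescope (F : nat -> R) n m :
  lsum (fun i => F (S i)) (seq m n) - lsum F (seq m n) = F (m + n)%nat - F m.
Proof.
elim: n m => [|n IH] m; first by rewrite /lsum /= Nat.add_0_r; ring.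
have := IH (S m); rewrite /lsum /= -/(lsum F _) -/(lsum (fun i => F (S i)) _).
have -> : (m + S n = S (m + n))%nat by lia.
lra.
Qed.

Definition average (A : list G) (M : (X -> R) -> R) (f : X -> R) : R :=
  / INR (length A) * lsum (fun a => M (fun x => f (act a x))) A.

Lemma average_mean A M : A <> nil -> mean M -> mean (average A M).
Proof.
move=> hA [Madd [Mpos M1]].
have hlen : 0 < INR (length A) by apply: lt_0_INR; case: (A) hA => [//|a l _] /=; lia.
have hinv := Rinv_0_lt_compat _ hlen.
split=> [f g|].
  rewrite /average -Rmult_plus_distr_l; congr (_ * _).
  elim: (A) => [|a l IH]; rewrite /lsum /=; first by ring.
  by rewrite -!/(lsum _ l) IH Madd; ring.
split=> [f hf|].
  apply: Rmult_le_pos; first lra.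
  elim: (A) => [|a l IH]; rewrite /lsum /=; first by lra.
  by have : 0 <= M (fun x => f (act a x)) by [apply: Mpos]; rewrite -/(lsum _ l); lra.
rewrite /average.
have -> : lsum (fun a => M (fun _ => 1)) A = INR (length A); last by field; lra.
elim: (A) => [//|a l IH].
by rewrite (S_INR (length l) : INR (length (a :: l)) = _) /lsum /= -/(lsum _ l) IH M1; ring.
Qed.

Lemma average_close A (F F' : G -> R) e : A <> nil -> (forall a, In a A -> Rabs (F a - F' a) <= e) ->
  Rabs (/ INR (length A) * lsum F A - / INR (length A) * lsum F' A) <= e.
Proof.
move=> hA h.
have hlen : 0 < INR (length A) by apply: lt_0_INR; case: (A) hA => [//|a l _] /=; lia.
have hinv := Rinv_0_lt_compat _ hlen.
rewrite -Rmult_minus_distr_l Rabs_mult (Rabs_right (/ _)); last lra.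
apply: Rle_trans (Rmult_le_compat_l _ _ _ (Rlt_le _ _ hinv) (lsum_close F F' A e h)) _.
by rewrite -Rmult_assoc Rinv_l; lra.
Qed.

Lemma unit_act f g : unit_valued f -> unit_valued (fun x => f (act g x)).
Proof. by move=> h x; apply: h. Qed.

Lemma act_fun f g h : (fun x => f (act g (act h x))) = (fun x : X => f (act (g ** h) x) : R).
Proof. by apply: functional_extensionality => x; rewrite act_mul. Qed.

Variable H : G -> Prop.
Hypothesis H_index : finite_index G H.
Local Notation N := (commutator_subgroup G H).
Hypothesis N_fixed : forall l, (forall g, In g l -> N g) ->
  exists y, forall g, generated G l g -> act g y = y.

(* [E] is treated one generator [g] at a time, by averaging over an initial segment of the powers
   of [g]; the commutators with these powers lie in [N] and are added to [C]. *)
Lemma almost_invariant_H E : forall e C, 0 < e -> (forall c, In c C -> N c) ->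
  exists M, mean M /\ forall g, (In g E /\ H g) \/ In g C -> almost_invariant e M g.
Proof.
have [[s1 [sM sV]] _] := H_index.
elim: E => [|g E IH] e C he hC.
  have [y hy] := N_fixed C hC; exists (fun f => f y); split.
    by split=> //; split=> // f; apply.
  move=> g [[[]]|hg] f _; rewrite hy; last by move=> K _; apply.
  by rewrite Rminus_diag Rabs_R0; lra.
case: (classic (H g)) => Hg; last first.
  have [M [hM hinv]] := IH e C he hC; exists M; split=> // k.
  by move=> [[[eg|hk] Hk]|hk]; [rewrite eg in Hg| |]; auto.
have [n [hn hn0]] := archimed_cor1 e he.
pose A := map (gpow g) (seq 0 n).
have lenA : length A = n by rewrite length_map length_seq.
have neA : A <> nil by move=> eA; move: lenA; rewrite eA /=; lia.
have HA a : In a A -> H a.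
  by move=> /in_map_iff [i [<- _]]; apply: gpow_sub.
pose C' := flat_map (fun a : G => map (fun k : G => match excluded_middle_informative (H k) with
    | left _ => ginv k ** ginv a ** (k ** a) | right _ => gone end) E
  ++ map (fun c : G => ginv a ** c ** a) C) A.
(* Moving [k] past [a] costs the commutator of [k] and [a]; one half of [e] pays for [k], the other
   for the commutator. *)
have [||M [hM hinv]] := IH (e / 2) C'; first lra.
  move=> c /in_flat_map [a [ha /(in_app_or _ _ _) [|] /in_map_iff [k [<-]]]].
    case: excluded_middle_informative => Hk _; first by apply: commutator_in; auto.
    by apply (commutator_is_subgroup G H).
  by move=> /hC hk; apply: commutator_normal; auto; case: H_index.
exists (average A M); split; first exact: average_mean.
move=> k hk f hf.
have [[ek Hk]|hk'] : (k = g /\ H g) \/ ((In k E /\ H k) \/ In k C).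
- by case: hk => [[[->|hk] Hk]|hk]; auto.
- rewrite ek /average lenA !lsum_map -Rmult_minus_distr_l.
  pose F i := M (fun x => f (act (gpow g i) x)).
  have -> : (fun i => M (fun x => f (act g (act (gpow g i) x)))) = (fun i => F (S i)).
    by apply: functional_extensionality => i; rewrite act_fun.
  rewrite -/F lsum_telescope.
  have hF i : 0 <= F i <= 1 by apply: mean_unit => //; apply: unit_act.
  have hninv := Rinv_0_lt_compat _ (lt_0_INR _ hn0).
  rewrite Rabs_mult (Rabs_right (/ _)); last lra.
  have h1 : Rabs (F (0 + n)%nat - F 0%nat) <= 1.
    by have := hF (0 + n)%nat; have := hF 0%nat; move=> *; apply: Rabs_le; lra.
  have := Rmult_le_compat_l _ _ _ (Rlt_le _ _ hninv) h1; lra.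
rewrite /average; apply: average_close => // a ha.
have hfa : unit_valued (fun x => f (act a x)) by apply: unit_act.
have hCa c : In c C' -> forall f', unit_valued f' -> Rabs (M (fun x => f' (act c x)) - M f') <= e / 2.
  by move=> hc; apply: hinv; right.
case: hk' => [[kE Hk]|kC].
  set c := ginv k ** ginv a ** (k ** a).
  have e1 : k ** a = a ** (k ** c) by rewrite /c !gmulA gmulK gVmul gmul1.
  have hin : In c C'.
    apply/in_flat_map; exists a; split=> //; apply: in_or_app; left.
    by apply/in_map_iff; exists k; case: excluded_middle_informative.
  have h1 := hCa c hin (fun x => f (act a (act k x))) (unit_act _ k hfa).
  have h2 := hinv k (or_introl (conj kE Hk)) _ hfa.
  rewrite act_fun e1 -(act_fun f a (k ** c)).
  have -> : (fun x => f (act a (act (k ** c) x))) = (fun x => f (act a (act k (act c x)))).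
    by apply: functional_extensionality => x; rewrite act_mul.
  move: h1 h2; rewrite /=.
  set u := M (fun x => f (act a (act k (act c x)))); set v := M (fun x => f (act a (act k x))).
  set w := M _ => h1 h2; have -> : u - w = (u - v) + (v - w) by ring.
  by apply: Rle_trans (Rabs_triang _ _) _; lra.
rewrite act_fun.
have -> : k ** a = a ** (ginv a ** k ** a) by rewrite !gmulA gVmul gmul1.
rewrite -(act_fun f a).
have hin : In (ginv a ** k ** a) C'.
  by apply/in_flat_map; exists a; split=> //; apply: in_or_app; right; apply/in_map_iff; exists k.
by have := hCa _ hin _ hfa; lra.
Qed.

Lemma coset_representatives : exists l, l <> nil /\
  ForallOrdPairs (fun a b => ~ H (ginv a ** b)) l /\ forall g, exists h, In h l /\ H (ginv h ** g).
Proof.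
have [[s1 [sM sV]] [l0 hl0]] := H_index.
have [l [hp hl]] : exists l, ForallOrdPairs (fun a b => ~ H (ginv a ** b)) l /\
    forall h, In h l0 -> exists h', In h' l /\ H (ginv h' ** h).
  elim: l0 {hl0} => [|a l0 [l [hp hl]]]; first by exists nil; split=> //; constructor.
  case: (classic (exists h', In h' l /\ H (ginv h' ** a))) => ha.
    by exists l; split=> // h [<-|/hl].
  exists (a :: l); split.
    constructor=> //; apply/Forall_forall => b hb hab; apply: ha; exists b; split=> //.
    by have := sV _ hab; rewrite ginvM ginvK.
  move=> h [<-|/hl [h' [h1 h2]]]; first by exists a; rewrite gmulV; split=> //; left.
  by exists h'; split=> //; right.
have hcov g : exists h, In h l /\ H (ginv h ** g).
  have [h [h1 h2]] := hl0 g; have [h' [h3 h4]] := hl h h1; exists h'; split=> //.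
  by have := sM _ _ h4 h2; rewrite gmulA gmulK.
by exists l; split=> // el; have [h [hh _]] := hcov gone; rewrite el in hh.
Qed.

(** Average over a transversal of [H]: left multiplication by [g] permutes it up to right factors in
    [H], collected in [E']. *)
Lemma almost_invariant_G (E : list G) e : 0 < e ->
  exists M, mean M /\ forall g, In g E -> almost_invariant e M g.
Proof.
move=> he; have [[s1 [sM sV]] _] := H_index.
have [l [nel [hp hcov]]] := coset_representatives.
pose s g := proj1_sig (constructive_indefinite_description _ (hcov g)).
have hs g : In (s g) l /\ H (ginv (s g) ** g).
  exact: (proj2_sig (constructive_indefinite_description _ (hcov g))).
pose E' := flat_map (fun g : G => map (fun a : G => ginv (s (g ** a)) ** (g ** a)) l) E.
have [|c []|M [hM hinv]] := almost_invariant_H E' e nil => //.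
exists (average l M); split; first exact: average_mean.
have hinj a b : In a l -> In b l -> H (ginv a ** b) -> a = b.
  elim: hp => [//|c m hc _ IH] [ea|ha] [eb|hb] hab; first by rewrite -ea.
  - by move/Forall_forall: hc => /(_ b hb); rewrite ea.
  - move/Forall_forall: hc => /(_ a ha); rewrite eb; case.
    by have := sV _ hab; rewrite ginvM ginvK.
  exact: IH.
move=> g hg f hf.
have hnd : NoDup l.
  elim: hp {hinj hcov s hs E' nel hinv} => [|c m hc _ IH]; constructor=> // hin.
  by move/Forall_forall: hc => /(_ c hin); rewrite gmulV.
have perm : Permutation l (map (fun a : G => s (g ** a)) l).
  apply: Permutation_sym; apply: NoDup_Permutation_bis.
  - apply: NoDup_map_NoDup_ForallPairs => // a b ha hb eab.
    apply: hinj => //; have [_ h1] := hs (g ** a); have [_ h2] := hs (g ** b).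
    rewrite eab in h1; have := sM _ _ (sV _ h1) h2.
    by rewrite !ginvM ginvK !gmulA gmulK gmulVK.
  - by rewrite length_map.
  by move=> b /in_map_iff [a [<- _]]; case: (hs (g ** a)).
rewrite /average (lsum_perm (fun a => M (fun x => f (act a x))) _ _ perm) lsum_map.
apply: average_close => // a ha; have [_ h1] := hs (g ** a).
rewrite act_fun -{1}(gmul_ginvK _ (s (g ** a)) (g ** a)) -act_fun.
apply: (hinv (ginv (s (g ** a)) ** (g ** a))); last exact: unit_act.
left; split=> //; apply/in_flat_map; exists g; split=> //.
by apply/in_map_iff; exists a.
Qed.

Variable x0 : X.
Hypothesis stab_amenable : forall x, amenable_sub G (stabiliser G X act x).

Lemma amenable_of_stabilisers : amenable G.
Proof.
pose S x := stabiliser G X act x.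
pose m0 x := proj1_sig (constructive_indefinite_description _ (stab_amenable x)).
have hm0 x : (forall A, (forall g, A g -> S x g) -> 0 <= m0 x A) /\ m0 x (S x) = 1 /\
    (forall A B, (forall g, A g -> S x g) -> (forall g, B g -> S x g) ->
       (forall g, A g -> B g -> False) -> m0 x (fun g => A g \/ B g) = m0 x A + m0 x B) /\
    (forall g A, S x g -> (forall k, A k -> S x k) -> m0 x (fun k => A (ginv g ** k)) = m0 x A).
  exact: (proj2_sig (constructive_indefinite_description _ (stab_amenable x))).
(* The predicate given to [epsilon] depends only on the orbit of [y], so extensionality makes [rep]
   constant on orbits. *)
pose rep y := epsilon (inhabits x0) (fun z => exists g, y = act g z).
have hrep y : exists g, y = act g (rep y).
  by apply: (epsilon_spec (inhabits x0) (fun z => exists g, y = act g z)); exists y, gone.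
have rep_act g y : rep (act g y) = rep y.
  rewrite /rep; congr epsilon; apply: pred_ext => z; split=> -[k hk].
    by exists (ginv g ** k); rewrite act_mul -hk -act_mul gmulV act_one.
  by exists (g ** k); rewrite act_mul -hk.
pose t y := proj1_sig (constructive_indefinite_description _ (hrep y)).
have ht y : y = act (t y) (rep y).
  exact: (proj2_sig (constructive_indefinite_description _ (hrep y))).
(* The stabiliser mean at the chosen orbit representative, transported to a mean on [G] attached
   to the point [y]; the choice of [t y] is immaterial by invariance under the stabiliser. *)
pose phi (A : G -> Prop) y := m0 (rep y) (fun h => S (rep y) h /\ A (t y ** h)).
have phi_act A g y : phi A (act g y) = phi (fun z => A (g ** z)) y.
  rewrite /phi rep_act; set z := rep y; set t' := t (act g y).
  have et : act t' z = act g y by rewrite /t' /z -(rep_act g y) -ht.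
  set k := ginv (g ** t y) ** t'.
  have ek : t' = g ** t y ** k by rewrite /k gmul_ginvK.
  have Sk : act k z = z.
    have eg : act g y = act (g ** t y) z by rewrite act_mul -ht.
    by rewrite /k act_mul et eg -act_mul gmulV act_one.
  have Sk' : act (ginv k) z = z by rewrite -{1}Sk -act_mul gmulV act_one.
  have [_ [_ [_ hinv]]] := hm0 z.
  rewrite -(hinv (ginv k) (fun h => S z h /\ A (g ** (t y ** h)))) //; last by move=> ? [].
  congr (m0 z _); apply: pred_ext => h; rewrite ginvK ek /S /stabiliser act_mul !gmulA.
  split=> -[h1 h2]; split=> //; first by rewrite h1.
  by rewrite -(act_one (act h z)) -(gmulV _ k) act_mul h1.
have phi_ge0 A y : 0 <= phi A y.
  by have [h _] := hm0 (rep y); apply: h => g [].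
have phi_add A B y : (forall g, A g -> B g -> False) ->
    phi (fun g => A g \/ B g) y = phi A y + phi B y.
  move=> hAB; have [_ [_ [hadd _]]] := hm0 (rep y); rewrite /phi -hadd.
  - congr (m0 _ _); apply: pred_ext => g; tauto.
  - by move=> g [].
  - by move=> g [].
  by move=> g [_ h1] [_ h2]; apply: hAB h1 h2.
have phiT y : phi (fun _ => True) y = 1.
  have [_ [<- _]] := hm0 (rep y); congr (m0 _ _); apply: pred_ext => g; tauto.
have phi_unit A : unit_valued (phi A).
  move=> y; split=> //; rewrite -(phiT y).
  have -> : (fun _ : G => True) = (fun g => A g \/ ~ A g).
    by apply: pred_ext => g; split=> // _; apply: classic.
  by rewrite phi_add; [have := phi_ge0 (fun g => ~ A g) y; lra|move=> g ? ?].
have hM (j : list G * nat) : exists M, mean M /\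
    forall g, In g (fst j) -> almost_invariant (/ INR (Datatypes.S (snd j))) M g.
  by apply: almost_invariant_G; apply: Rinv_0_lt_compat; apply: lt_0_INR; lia.
pose M j := proj1_sig (constructive_indefinite_description _ (hM j)).
have hM' j : mean (M j) /\
    forall g, In g (fst j) -> almost_invariant (/ INR (Datatypes.S (snd j))) (M j) g.
  exact: (proj2_sig (constructive_indefinite_description _ (hM j))).
have [||| U [U_up [U_and [U_ne [U_ultra U_le]]]]] := ultrafilter_ex
  (fun j k : list G * nat => incl (fst j) (fst k) /\ (snd j <= snd k)%nat) (nil, 0%nat).
- by move=> j; split=> // g.
- by move=> i j k [h1 h2] [h3 h4]; split; [apply: incl_tran h1 h3|lia].
- move=> i j; exists (fst i ++ fst j, (snd i + snd j)%nat) => /=; split; split; try lia.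
    exact/incl_appl/incl_refl.
  exact/incl_appr/incl_refl.
pose u A j := M j (phi A).
have hL A : exists l, ulim _ U (u A) l.
  by apply: ulim_ex => // j; apply: mean_unit => //; case: (hM' j).
pose L A := proj1_sig (constructive_indefinite_description _ (hL A)).
have hL' A : ulim _ U (u A) (L A).
  exact: (proj2_sig (constructive_indefinite_description _ (hL A))).
exists L; split.
  move=> A _; apply: (ulim_ge0 _ U U_ne _ _ _ (hL' A)) => j.
  by have [[_ [h _]] _] := hM' j; apply: h.
split.
  apply: (ulim_uniq _ U U_up U_and U_ne _ _ _ (hL' _)).
  have -> : u (fun _ => True) = (fun _ => 1); last exact: ulim_const.
  apply: functional_extensionality => j; rewrite /u.
  have -> : phi (fun _ => True) = (fun _ => 1) by apply: functional_extensionality.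
  by case: (hM' j) => -[_ []].
split.
  move=> A B _ _ hAB; apply: (ulim_uniq _ U U_up U_and U_ne _ _ _ (hL' _)).
  have -> : u (fun g => A g \/ B g) = (fun j => u A j + u B j); last exact: ulim_add.
  apply: functional_extensionality => j; rewrite /u; have [[<- _] _] := hM' j; congr (M j _).
  by apply: functional_extensionality => y; apply: phi_add.
move=> g A _ _.
have hle : Rabs (L (fun k => A (ginv g ** k)) - L A) <= 0.
  apply: (ulim_close _ U U_and U_ne _ _ _ _ _ _ (hL' _) (hL' _)) => e he.
  have [n [hn hn0]] := archimed_cor1 e he.
  apply: U_up (U_le (ginv g :: nil, n)) _ => j /= [hin hnj].
  have [_ hinv] := hM' j.
  have := hinv (ginv g) (hin _ (or_introl eq_refl)) (phi A) (phi_unit A).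
  have -> : (fun y => phi A (act (ginv g) y)) = phi (fun k => A (ginv g ** k)).
    by apply: functional_extensionality => y; rewrite phi_act.
  have : / INR (Datatypes.S (snd j)) <= / INR n.
    by apply: Rinv_le_contravar; [apply: lt_0_INR|apply: le_INR; lia].
  by rewrite -/(u _ j) -/(u A j); lra.
have := Rle_abs (L (fun k => A (ginv g ** k)) - L A).
have := Rle_abs (L A - L (fun k => A (ginv g ** k))); rewrite (Rabs_minus_sym (L A)); lra.
Qed.

End InvariantMeans.

Lemma finite_rank_family (X : Type) (d : X -> X -> R) : finite_rank X d ->
  exists r, forall f : nat -> X -> Prop, (forall i, (i <= r)%nat -> halfspace X d (f i)) ->
    (forall i j, (i < j <= r)%nat -> transverse X (f i) (f j)) -> False.
Proof.
move=> [r hr]; exists r => f hf ht.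
have hnth i : (i < S r)%nat -> nth i (map f (seq 0 (S r))) (fun _ => False) = f i.
  move=> hi; rewrite (nth_indep _ _ (f 0%nat)); last by rewrite length_map length_seq.
  by rewrite map_nth seq_nth.
have := hr (map f (seq 0 (S r))); rewrite length_map length_seq => h.
suff : (S r <= r)%nat by lia.
apply: h => [k /in_map_iff [i [<- /in_seq hi]]|i j hij]; first by apply: hf; lia.
by rewrite !hnth; [apply: ht; lia|lia|lia].
Qed.

Theorem theoremA (G : Group) (X : Type) (d : X -> X -> R) (act : G -> X -> X) :
  inhabited X -> median_space X d -> complete X d -> finite_rank X d ->
  isometric_action G X d act ->
  ~ has_nonabelian_free_subgroup G ->
  (free_action G X act ->
     virtually_by_abelian G (finite_sub G) /\
     ((connected_space X d \/ finitely_generated G) -> virtually_abelian G)) /\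
  (metrically_proper G X d act ->
     virtually_by_abelian G (locally_finite_sub G)) /\
  ((forall x : X, amenable_sub G (stabiliser G X act x)) -> amenable G).
Proof.
move=> [x] HX HC /finite_rank_family [r Hr] Hact nf.
have [H [hidx hfix]] := locally_elliptic_commutators X d HX HC r Hr G act Hact x nf.
set N := commutator_subgroup G H in hfix.
have hN : normal_in G N H.
  split; first exact: commutator_is_subgroup.
  split; first by move=> g; apply: commutator_sub; case: hidx.
  by move=> g c; apply: commutator_normal; case: hidx.
have hab : abelian_quotient G H N by move=> a b; apply: commutator_in.
have fixed1 g : N g -> exists y, act g y = y.
  move=> Ng; have [k [<-|[]]|y hy] := hfix (g :: nil); first exact: Ng.
  by exists y; apply: hy => K _; apply; left.
split.
  move=> free; have N1 g : N g -> g = gone by move=> /fixed1 [y]; apply: free.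
  split.
    exists H, N; split=> //; split=> //; split=> //.
    by exists (gone :: nil) => g /N1 ->; left.
  move=> _; exists H; split=> // a b Ha Hb.
  have e := N1 _ (hab a b Ha Hb).
  by rewrite -(gmul1r _ (b ** a)) -e -!gmulA gmul_ginvK gmul_ginvK.
split.
  move=> proper; exists H, N; split=> //; split=> //; split=> // l hl.
  (* Properness at radius 0 says that the stabiliser of [y] is finite. *)
  have [y hy] := hfix l hl; have [m hm] := proper y 0.
  exists m => g hg; apply: hm; rewrite (hy g hg).
  by rewrite (dist_xx X d HX); lra.
move=> stab; have [act_one [act_mul _]] := Hact.
by apply: (amenable_of_stabilisers G X act act_one act_mul H hidx hfix x).
Qed.
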